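(* Let $\mathbb{F}_q$ be a finite field and let $N$ be a normal genuine non-congruence subgroup of $G=GL_2(\mathbb{F}_q[t])$. Then $|G:N|$ is divisible by $$\begin{cases} q\,|PGL_2(\mathbb{F}_q)|=q^4-q^2, & \text{if } q>3,\\ q^2, & \text{if } q\le 3.\end{cases}$$ In particular, $$\mathrm{ngncs}(G)>\mathrm{nncs}(G).$$
   Context: Let $A=\mathbb{F}_q[t]$ and $\Gamma=SL_2(A)$. For an ideal $\mathfrak{q}$ of $A$ let $\Gamma(\mathfrak{q})=\{M\in\Gamma: M\equiv I_2 \pmod{\mathfrak{q}}\}$. A subgroup of $G$ is a congruence subgroup if it contains $\Gamma(\mathfrak{q}')$ for some non-zero ideal $\mathfrak{q}'$ of $A$; a finite index subgroup of $G$ that is not congruence is a non-congruence subgroup. A finite index subgroup $S$ of $G$ is a genuine non-congruence subgroup of $G$ if $\Psi(S)$ is a non-congruence subgroup for every (abstract group) automorphism $\Psi\in\mathrm{Aut}(G)$. $\mathrm{nncs}(G)$ and $\mathrm{ngncs}(G)$ denote the smallest index in $G$ of, respectively, a normal non-congruence subgroup and a normal genuine non-congruence subgroup of $G$. *)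

(* Defs.v *)
From HB Require Import structures.
From mathcomp Require Import all_boot all_order all_algebra all_fingroup all_solvable.
From mathcomp Require Import boolp classical_sets functions finmap cardinality.

Set Implicit Arguments.
Unset Strict Implicit.
Unset Printing Implicit Defensive.

Import GRing.Theory.

Local Open Scope classical_set_scope.
Local Open Scope ring_scope.

(* MathComp's {'GL_n[R]} requires a finite ring R, hence this groupType. *)
Record GL2 (R : comUnitRingType) := MkGL2 {
  GL2val :> 'M[R]_2;
  GL2valP : GL2val \in unitmx }.

HB.instance Definition _ (R : comUnitRingType) := [isSub for @GL2val R].
HB.instance Definition _ (R : comUnitRingType) := [Choice of GL2 R by <:].

Section GL2Group.
Variable R : comUnitRingType.
Implicit Types M N P : GL2 R.

Fact GL2_mul_proof M N : (M : 'M_2) *m N \in unitmx.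
Proof. by rewrite unitmx_mul !GL2valP. Qed.
Definition GL2_mul M N : GL2 R := MkGL2 (GL2_mul_proof M N).
Definition GL2_one : GL2 R := MkGL2 (unitmx1 R 2).
Fact GL2_inv_proof M : invmx M \in unitmx.
Proof. by rewrite unitmx_inv GL2valP. Qed.
Definition GL2_inv M : GL2 R := MkGL2 (GL2_inv_proof M).

Fact GL2_mulA : associative GL2_mul.
Proof. by move=> M N P; apply: val_inj; rewrite /= mulmxA. Qed.
Fact GL2_mul1 : left_id GL2_one GL2_mul.
Proof. by move=> M; apply: val_inj; rewrite /= mul1mx. Qed.
Fact GL2_mulV : left_inverse GL2_one GL2_inv GL2_mul.
Proof. by move=> M; apply: val_inj; rewrite /= mulVmx ?GL2valP. Qed.
Fact GL2_1mul : right_id GL2_one GL2_mul.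
Proof. by move=> M; apply: val_inj; rewrite /= mulmx1. Qed.
Fact GL2_Vmul : right_inverse GL2_one GL2_inv GL2_mul.
Proof. by move=> M; apply: val_inj; rewrite /= mulmxV ?GL2valP. Qed.

HB.instance Definition _ := isGroup.Build (GL2 R)
  GL2_mulA GL2_mul1 GL2_1mul GL2_mulV GL2_Vmul.
End GL2Group.

Section AbstractGroup.
Variable G : groupType.
Implicit Types S N : set G.

Definition is_subgroup S : Prop :=
  [/\ S 1%g, forall x y, S x -> S y -> S (x * y)%g & forall x, S x -> S x^-1%g].

Definition is_normal_subgroup N : Prop :=
  is_subgroup N /\ forall x g, N x -> N (x ^ g)%g.

Definition left_cosets S : set (set G) :=
  [set C | exists g : G, C = [set (g * x)%g | x in S]].

Definition finite_index S : Prop := finite_set (left_cosets S).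

(* Meaningful only when S has finite index; fset_set is empty otherwise. *)
Definition subgroup_index S : nat := #|` fset_set (left_cosets S)|%fset.

End AbstractGroup.

(* MathComp's closure predicates for ideals impose 1 \notin I, which the
   ideals here do not. *)
Definition is_ideal (R : comNzRingType) (I : set R) : Prop :=
  [/\ I 0, forall a b, I a -> I b -> I (a + b) & forall a b, I b -> I (a * b)].

Section Congruence.
Variable F : finFieldType.
Local Notation A := {poly F}.
Local Notation G := (GL2 {poly F}).
Implicit Types S N : set G.

Definition SL2 : set G := [set M : G | \det M = 1].

Definition Gamma (I : set A) : set G :=
  [set M : G | SL2 M /\ forall i j, I (((M : 'M[A]_2) - 1%:M) i j)].

Definition congruence_subgroup S : Prop :=
  is_subgroup S /\
  exists I : set A, [/\ is_ideal I, I <> [set 0] & Gamma I `<=` S].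

Definition non_congruence_subgroup S : Prop :=
  [/\ is_subgroup S, finite_index S & ~ congruence_subgroup S].

Definition genuine_non_congruence_subgroup S : Prop :=
  [/\ is_subgroup S, finite_index S &
      forall Psi : {multiplicative G -> G}, bijective Psi ->
        non_congruence_subgroup [set Psi x | x in S]].

End Congruence.

(* The least element of P, and 0 if P is empty. *)
Definition least (P : set nat) : nat :=
  xget 0%N [set n | P n /\ forall m, P m -> (n <= m)%N].

(* An index is positive, so a value 0 below would mean that no subgroup of the
   given kind exists. *)
Definition nncs (F : finFieldType) : nat :=
  least [set subgroup_index N | N in
    [set N : set (GL2 {poly F}) | is_normal_subgroup N /\
                                  non_congruence_subgroup N]].

Definition ngncs (F : finFieldType) : nat :=
  least [set subgroup_index N | N in
    [set N : set (GL2 {poly F}) | is_normal_subgroup N /\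
                                  genuine_non_congruence_subgroup N]].

Definition card_PGL2 (F : finFieldType) : nat :=
  #|('GL_2[F] / 'Z('GL_2[F]))%g|.

(* Main.v *)
From HB Require Import structures.
From mathcomp Require Import all_boot all_algebra all_fingroup all_solvable.
From mathcomp Require Import all_field.
From mathcomp Require Import boolp classical_sets finmap cardinality.
From mathcomp Require Import ring zify.
Require Import Defs.

(** Write [q] for the number of elements of [F], [A] for [{poly F}], [G] for
    [GL2 A], and [E12 b] for the elementary matrix with upper right entry [b].

    By the theorem of Nagao, [G] is an amalgam of the constant matrices and of
    the upper triangular ones: a homomorphism on [GL2 F] and a compatible
    additive map on [A] extend to [G] ([GL2_poly_extension]; the extension is
    defined along the Euclidean algorithm on the first column). This has three
    uses. An [F]-linear bijection of [A] fixing [1] extends to an automorphism of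
    [G], called a Reiner automorphism ([reiner_auto]). A linear form [l] with
    [l 1 = 1] gives a retraction of [G] onto [GL2 F] sending [E12 b] to
    [E12 (l b)] ([retraction]). If [q <= 3], a linear form [l] with [l 1 = 0]
    gives a homomorphism to the affine group of the line, again with [E12 b]
    sent to [E12 (l b)] ([affine_quotient]).

    Divisibility. Let [N] be normal of finite index and let [V] be the subspace
    of the [b] with [E12 b] in [N]. If [V] is everything then [N] contains [SL2].
    If [V] is the kernel of a nonzero form [l], then either [V] contains [1] and
    [q > 3], which is absurd as [V] is then everything ([level1_full]), or [N]
    contains the kernel of a homomorphism attached as above to a multiple of [l].
    In the last case a Reiner automorphism replaces [l] by the value at [0], or by the
    difference of the values at [1] and [0]; for these forms the kernel contains
    some [Gamma], which for the second one is seen from an explicit character of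
    the special linear group of a field with two or three elements
    ([affine_quotient_chi]). So if [N] is genuine, then [V] has codimension at
    least two ([genuine_independent]), and [q ^ 2] divides the index. If also
    [q > 3], then [E12 1] is not in [N], so [N] contains only scalar constant
    matrices ([nonscalar_elementary]) and the order of [PGL2 F] divides the
    index. As [q ^ 2] is prime to [q ^ 2 - 1], the two divisors combine.

    Comparison. A kernel as above for a form which does not vanish on any nonzero
    ideal ([sparse_form_ideal]) is a non-congruence subgroup, and its index is
    smaller than the divisor just found. A normal genuine subgroup exists as
    well: the intersection of [2 * q + 1] kernels of retractions attached to
    independent forms ([common_kernel_genuine]). For if an automorphism carries
    it to a congruence subgroup, the units modulo the level act by conjugation on
    the elementary matrices, and on the other side only constants can act on
    each of the quotients; an automorphism of [G] preserves the group of
    elementary matrices up to conjugation ([automorphism_E12]), so the two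
    actions can be compared. This forces the forms to vanish, up to an additive
    bijection of [A], on the ideal of the square of ['X^q - 'X]
    ([linear_product_sqr]), whose codimension [2 * q] is too small. *)

Set Implicit Arguments.
Unset Strict Implicit.
Unset Printing Implicit Defensive.

Import GRing.Theory.
Local Open Scope ring_scope.

(* Group products written without [%g], which would also change the reading of
   the ring expressions inside them. *)
Local Notation "x *g y" := (mul x%R y%R) (at level 40, left associativity).

(** * Two by two matrices *)

Lemma ord2P (k : 'I_2) : k = 0 \/ k = 1.
Proof. by case: k => [[|[|[]]] ?] //; [left | right]; apply/val_inj. Qed.

Section Mx2.
Variable R : comUnitRingType.
Implicit Types (a b c d : R) (x y : GL2 R).

(** The matrix with rows [a, b] and [c, d]. *)
Definition mx2 a b c d : 'M[R]_2 :=
  \matrix_(i, j) if i == 0 then (if j == 0 then a else b)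
                 else (if j == 0 then c else d).

Lemma mx2P (M N : 'M[R]_2) :
  M 0 0 = N 0 0 -> M 0 1 = N 0 1 -> M 1 0 = N 1 0 -> M 1 1 = N 1 1 -> M = N.
Proof.
move=> e00 e01 e10 e11; apply/matrixP => i j.
by case: (ord2P i) => ->; case: (ord2P j) => ->.
Qed.

Lemma mulmx2E (M N : 'M[R]_2) i j :
  (M *m N) i j = M i 0 * N 0 j + M i 1 * N 1 j.
Proof.
rewrite mxE big_ord_recl big_ord1.
by congr (_ + M i _ * N _ j); apply/val_inj.
Qed.

Lemma det_mx2 (M : 'M[R]_2) : \det M = M 0 0 * M 1 1 - M 0 1 * M 1 0.
Proof.
rewrite (expand_det_row _ 0) big_ord_recl big_ord1 /cofactor !det_mx11 !mxE /=.
rewrite expr0 mul1r /bump /= addn0 expr1 mulN1r mulrN.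
by congr (M _ _ * M _ _ - M _ _ * M _ _); apply/val_inj.
Qed.

Lemma GL2P x y : x 0 0 = y 0 0 -> x 0 1 = y 0 1 -> x 1 0 = y 1 0 ->
  x 1 1 = y 1 1 -> x = y.
Proof. by move=> *; apply/val_inj/mx2P. Qed.

Lemma GL2M x y i j : (x *g y) i j = x i 0 * y 0 j + x i 1 * y 1 j.
Proof. exact: mulmx2E. Qed.

Lemma GL2_1E :
  ((1%g : GL2 R) 0 0 = 1) * ((1%g : GL2 R) 0 1 = 0) *
  ((1%g : GL2 R) 1 0 = 0) * ((1%g : GL2 R) 1 1 = 1).
Proof. by do !split; rewrite /= mxE. Qed.

Lemma GL2_det x : x 0 0 * x 1 1 - x 0 1 * x 1 0 \is a GRing.unit.
Proof. by have := GL2valP x; rewrite unitmxE det_mx2. Qed.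

Lemma GL2_det_mul x y : \det (x *g y) = \det x * \det y.
Proof. exact: det_mulmx. Qed.

End Mx2.

(** The element of [GL2 R] with the given entries; it is the identity when
    their determinant is not a unit. *)
HB.lock Definition gl (R : comUnitRingType) (a b c d : R) : GL2 R :=
  insubd (1%g : GL2 R) (mx2 a b c d).

Section Generators.
Variable R : comUnitRingType.
Implicit Types (a b c d : R) (x y : GL2 R).

Lemma gl_val a b c d : a * d - b * c \is a GRing.unit ->
  gl a b c d = mx2 a b c d :> 'M_2.
Proof. by move=> u; rewrite gl.unlock val_insubd unitmxE det_mx2 !mxE /= u. Qed.

Lemma glE a b c d : a * d - b * c \is a GRing.unit ->
  (gl a b c d 0 0 = a) * (gl a b c d 0 1 = b) *
  (gl a b c d 1 0 = c) * (gl a b c d 1 1 = d).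
Proof. by move=> u; rewrite gl_val // !mxE. Qed.

(** The elementary matrix with upper right entry [b]. *)
Definition E12 b : GL2 R := gl 1 b 0 1.

(** The rotation exchanging the coordinate axes. *)
Definition Weyl : GL2 R := gl 0 1 (-1) 0.

Lemma E12E b :
  (E12 b 0 0 = 1) * (E12 b 0 1 = b) * (E12 b 1 0 = 0) * (E12 b 1 1 = 1).
Proof. by rewrite /E12 !glE // !mulr0 subr0 mulr1 unitr1. Qed.

Lemma WeylE :
  (Weyl 0 0 = 0) * (Weyl 0 1 = 1) * (Weyl 1 0 = -1) * (Weyl 1 1 = 0).
Proof. by rewrite /Weyl !glE // mulr0 mulrN1 opprK add0r unitr1. Qed.

Lemma E12D b c : E12 (b + c) = E12 b *g E12 c.
Proof. by apply: GL2P; rewrite !GL2M !E12E; ring. Qed.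

Lemma E12_0 : E12 0 = 1%g.
Proof. by apply: GL2P; rewrite !E12E !GL2_1E. Qed.

Lemma E12V b : (E12 b)^-1%g = E12 (- b).
Proof. by apply/mulg1_eq; rewrite -E12D subrr E12_0. Qed.

Lemma E12_inj : injective E12.
Proof. by move=> b c /(congr1 (fun g : GL2 R => g 0 1)); rewrite !E12E. Qed.

Lemma E12X b n : (E12 b ^+ n)%g = E12 (b *+ n).
Proof.
elim: n => [|n IH]; first by rewrite mulr0n E12_0.
by rewrite expgS IH -E12D mulrS.
Qed.

Lemma det_E12 b : \det (E12 b) = 1.
Proof. by rewrite det_mx2 !E12E mulr0 subr0 mulr1. Qed.

Lemma det_Weyl : \det Weyl = 1.
Proof. by rewrite det_mx2 !WeylE mul0r sub0r mulrN1 opprK. Qed.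

Lemma WeylVE : (Weyl^-1%g 0 0 = 0) * (Weyl^-1%g 0 1 = -1) *
  (Weyl^-1%g 1 0 = 1) * (Weyl^-1%g 1 1 = 0).
Proof.
have u : 0 * 0 - -1 * 1 \is a @GRing.unit R.
  by rewrite mulr0 mulN1r opprK add0r unitr1.
have -> : Weyl^-1%g = gl 0 (-1) 1 0.
  by apply/mulg1_eq/GL2P; rewrite !GL2M !WeylE !glE // !GL2_1E; ring.
by rewrite !glE.
Qed.

End Generators.

Arguments Weyl {R}.

(** Entrywise application of a ring morphism. *)
Section GLmap.
Variables (R S : comUnitRingType) (h : {rmorphism R -> S}).

Fact GLmap_proof (x : GL2 R) : map_mx h x \in unitmx.
Proof. by rewrite unitmxE det_map_mx rmorph_unit // -unitmxE GL2valP. Qed.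

Definition GLmap (x : GL2 R) : GL2 S := MkGL2 (GLmap_proof x).

Lemma GLmapE x i j : GLmap x i j = h (x i j).
Proof. by rewrite mxE. Qed.

Lemma GLmapM : {morph GLmap : x y / (x *g y) >-> (x *g y)}.
Proof. by move=> x y; apply/val_inj; rewrite /= map_mxM. Qed.

Lemma GLmap1 : GLmap 1%g = 1%g.
Proof. by apply/val_inj; rewrite /= map_mx1. Qed.

Lemma GLmap_E12 b : GLmap (E12 b) = E12 (h b).
Proof. by apply: GL2P; rewrite GLmapE !E12E ?rmorph1 ?rmorph0. Qed.

Lemma GLmap_Weyl : GLmap Weyl = Weyl.
Proof. by apply: GL2P; rewrite GLmapE !WeylE ?rmorphN ?rmorph1 ?rmorph0. Qed.

End GLmap.

Section Dg.
Variable F : fieldType.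
Implicit Types (a d : F) (x : GL2 F).

(** The diagonal matrix with entries [a] and [d], both meant to be nonzero. *)
Definition dg a d : GL2 F := gl a 0 0 d.

Lemma dgE a d : a != 0 -> d != 0 ->
  (dg a d 0 0 = a) * (dg a d 0 1 = 0) * (dg a d 1 0 = 0) * (dg a d 1 1 = d).
Proof.
by move=> a0 d0; rewrite /dg !glE // mulr0 subr0 unitfE mulf_neq0.
Qed.

Lemma dg11 : dg 1 1 = 1%g.
Proof. by apply: GL2P; rewrite !dgE ?oner_eq0 // !GL2_1E. Qed.

Lemma dg_det a d : a != 0 -> d != 0 -> \det (dg a d) = a * d.
Proof. by move=> a0 d0; rewrite det_mx2 !dgE // mul0r subr0. Qed.

Lemma dgM a d a' d' : a != 0 -> d != 0 -> a' != 0 -> d' != 0 ->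
  dg a d *g dg a' d' = dg (a * a') (d * d').
Proof.
by move=> *; apply: GL2P; rewrite !GL2M !dgE ?mulf_neq0 //; ring.
Qed.

Lemma dg_E12 a d b : a != 0 -> d != 0 ->
  dg a d *g E12 b = E12 (a / d * b) *g dg a d.
Proof.
by move=> a0 d0; apply: GL2P; rewrite !GL2M !dgE // !E12E; field.
Qed.

Lemma GL2F_det x : \det x != 0.
Proof. by rewrite -unitfE -unitmxE GL2valP. Qed.

(** The Bruhat decomposition, as an induction principle. *)
Lemma GL2_ind_bruhat (P : GL2 F -> Prop) :
  (forall a d, a != 0 -> d != 0 -> P (dg a d)) -> (forall c, P (E12 c)) ->
  P Weyl -> (forall x y, P x -> P y -> P (x *g y)) -> forall x, P x.
Proof.
move=> Pd Pe Pw PM x; have := GL2_det x; rewrite unitfE => Dx.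
have [c0|c0] := eqVneq (x 1 0) 0.
  move: Dx; rewrite c0 mulr0 subr0 mulf_eq0 negb_or => /andP[a0 d0].
  have -> : x = dg (x 0 0) (x 1 1) *g E12 (x 0 1 / x 0 0).
    by apply: GL2P; rewrite !GL2M !dgE // !E12E ?c0;
      move: (x 0 0) (x 0 1) (x 1 1) a0 d0 => a b d a0 d0; field.
  by apply: PM; [apply: Pd | apply: Pe].
pose D := x 0 0 * x 1 1 - x 0 1 * x 1 0.
have m0 : - x 1 0 != 0 by rewrite oppr_eq0.
have D0 : - (D / x 1 0) != 0 by rewrite oppr_eq0 mulf_neq0 // invr_eq0.
have -> : x = E12 (x 0 0 / x 1 0) *g Weyl *g dg (- x 1 0) (- (D / x 1 0))
              *g E12 (x 1 1 / x 1 0).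
  by apply: GL2P; rewrite !GL2M !dgE // !E12E !WeylE /D;
    move: (x 0 0) (x 0 1) (x 1 0) (x 1 1) c0 => a b c d c0; field.
exact: PM (PM _ _ (PM _ _ (Pe _) Pw) (Pd _ _ m0 D0)) (Pe _).
Qed.

End Dg.

(** * Homomorphisms out of [GL2 {poly F}] *)

Section Constants.
Variable F : fieldType.
Local Notation A := {poly F}.
Implicit Types (x : GL2 A).

(** The inclusion of the constant matrices. *)
Definition emb : GL2 F -> GL2 A := GLmap (@polyC F).

(** Evaluation of the entries at [c]. *)
Definition evalGL (c : F) : GL2 A -> GL2 F := GLmap (horner_eval c).

Lemma embM : {morph emb : x y / x *g y >-> x *g y}.
Proof. exact: GLmapM. Qed.

Lemma emb1 : emb 1%g = 1%g.
Proof. exact: GLmap1. Qed.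

Lemma embV g : emb g^-1%g = (emb g)^-1%g.
Proof. by apply/esym/mulg1_eq; rewrite -embM mulgV emb1. Qed.

Lemma evalGLM c : {morph evalGL c : x y / x *g y >-> x *g y}.
Proof. exact: GLmapM. Qed.

Lemma evalGL_emb c (g : GL2 F) : evalGL c (emb g) = g.
Proof. by apply: GL2P; rewrite !GLmapE /= /horner_eval hornerC. Qed.

Lemma emb_E12 (c : F) : emb (E12 c) = E12 c%:P.
Proof. exact: GLmap_E12. Qed.

Lemma emb_Weyl : emb Weyl = Weyl.
Proof. exact: GLmap_Weyl. Qed.

Lemma evalGL_E12 c b : evalGL c (E12 b) = E12 b.[c].
Proof. exact: GLmap_E12. Qed.

Lemma evalGL_Weyl c : evalGL c Weyl = Weyl.
Proof. exact: GLmap_Weyl. Qed.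

Lemma evalGLE c x i j : evalGL c x i j = (x i j).[c].
Proof. exact: GLmapE. Qed.

(** The units of [{poly F}] are the nonzero constants, so the diagonal of an
    invertible upper triangular matrix is constant. *)
Lemma GL2_upper x : x 1 0 = 0 ->
  [/\ (x 0 0)`_0 != 0, (x 1 1)`_0 != 0, x 0 0 = ((x 0 0)`_0)%:P
    & x 1 1 = ((x 1 1)`_0)%:P].
Proof.
move=> x10; have := GL2_det x; rewrite x10 mulr0 subr0 unitrM.
by rewrite !poly_unitE !unitfE => /andP[/andP[/eqP s0 ->] /andP[/eqP s1 ->]];
  split=> //; apply: size1_polyC; rewrite ?s0 ?s1.
Qed.

End Constants.

(** A homomorphism on [GL2 F] and an additive map on [{poly F}] which agree on
    the constant elementary matrices, and are compatible with conjugation by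
    diagonal matrices, extend to [GL2 {poly F}]. This is the amalgam
    decomposition of this group due to Nagao, read as a universal property. *)
Section Extension.
Variables (F : fieldType) (H : groupType) (f : GL2 F -> H) (u : {poly F} -> H).
Local Notation A := {poly F}.
Implicit Types (x y : GL2 A) (b c : A).
Local Notation sza x := (size (x 0 0)%R).
Local Notation szc x := (size (x 1 0)%R).

Hypothesis fM : {morph f : x y / x *g y >-> x *g y}.
Hypothesis uD : {morph u : b c / b + c >-> b *g c}.
Hypothesis fu : forall c : F, f (E12 c) = u c%:P.
Hypothesis fd : forall (a d : F) b, a != 0 -> d != 0 ->
  f (dg a d) *g u b = u ((a / d) *: b) *g f (dg a d).

(** One step of the Euclidean algorithm on the first column. *)
Definition euclid_step x : GL2 A :=
  Weyl^-1%g *g (E12 (- (x 0 0 %/ x 1 0)) *g x).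

Lemma euclid_stepE x : x 1 0 != 0 ->
  (euclid_step x 0 0 = - x 1 0) * (euclid_step x 1 0 = x 0 0 %% x 1 0).
Proof.
move=> c0; rewrite !GL2M !WeylVE !E12E.
split; first by ring.
rewrite {1}[x 0 0](divp_eq (x 0 0) (x 1 0)).
set k := _ %/ _; set r := _ %% _; ring.
Qed.

(** The extension, by recursion along the Euclidean algorithm. The bound [n] on
    the number of steps is to be at least the size of the lower left entry; the
    value [1] in the last case is then never reached. *)
Fixpoint extend_rec n x : H :=
  if x 1 0 == 0 then f (dg (x 0 0)`_0 (x 1 1)`_0) *g u (((x 0 0)`_0)^-1 *: x 0 1)
  else if n is m.+1 then
    u (x 0 0 %/ x 1 0) *g f Weyl *g extend_rec m (euclid_step x)
  else 1%g.

Definition extend x := extend_rec (szc x) x.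

Lemma size_euclid_step x : x 1 0 != 0 ->
  (szc (euclid_step x) < szc x)%N.
Proof. by move=> c0; rewrite euclid_stepE // ltn_modp. Qed.

Lemma extend_recE n x : (szc x <= n)%N -> extend_rec n x = extend x.
Proof.
rewrite /extend; elim: n {-2}n (leqnn n) x => [|k IH] n le_nk x.
  by move: le_nk; rewrite leqn0 => /eqP->; rewrite leqn0 => /eqP->.
case: n le_nk => [|n] le_nk sx; first by move: sx; rewrite leqn0 => /eqP->.
have [c0|c0] := eqVneq (x 1 0) 0; first by rewrite /= c0 eqxx size_poly0 /= c0 eqxx.
have lt_s := size_euclid_step c0.
have [m Em] : exists m, szc x = m.+1.
  by exists (szc x).-1; rewrite prednK // size_poly_gt0.
rewrite Em /= (negPf c0) !(IH n) // ?(IH m) //; try lia.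
Qed.

Lemma extend_upper x : x 1 0 = 0 ->
  extend x = f (dg (x 0 0)`_0 (x 1 1)`_0) *g u (((x 0 0)`_0)^-1 *: x 0 1).
Proof. by move=> x10; rewrite /extend x10 size_poly0 /= x10 eqxx. Qed.

Lemma extend_step x : x 1 0 != 0 ->
  extend x = u (x 0 0 %/ x 1 0) *g f Weyl *g extend (euclid_step x).
Proof.
move=> c0; have lt_s := size_euclid_step c0.
have [m Em] : exists m, szc x = m.+1.
  by exists (szc x).-1; rewrite prednK // size_poly_gt0.
rewrite {1}/extend Em /= (negPf c0) extend_recE //; lia.
Qed.

Lemma f1 : f 1%g = 1%g.
Proof. by apply: (@mulgI _ (f 1%g)); rewrite -fM !mulg1. Qed.

Lemma extendE12 b x : extend (E12 b *g x) = u b *g extend x.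
Proof.
have [c0|c0] := eqVneq (x 1 0) 0.
  have [a0 d0 xa xd] := GL2_upper c0.
  have Ec0 : (E12 b *g x) 1 0 = 0 by rewrite GL2M !E12E c0; ring.
  rewrite !extend_upper // !GL2M !E12E c0 !(mul0r, mulr0, mul1r, add0r, addr0).
  rewrite addrC scalerDr uD !mulgA; congr (_ *g _).
  rewrite [in b * _]xd mulrC mul_polyC scalerA fd //; congr (u _ *g _).
  rewrite scalerA; move: a0 d0; set p := _`_0; set r := (x 1 1)`_0 => p0 r0.
  by have -> : p / r * (p^-1 * r) = 1; [field; rewrite p0 r0 | rewrite scale1r].
have Ec : (E12 b *g x) 1 0 = x 1 0 by rewrite GL2M !E12E; ring.
have Ea : (E12 b *g x) 0 0 = x 0 0 + b * x 1 0 by rewrite GL2M !E12E; ring.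
have Eq : (E12 b *g x) 0 0 %/ x 1 0 = b + x 0 0 %/ x 1 0.
  by rewrite Ea divpD mulpK // addrC.
rewrite extend_step ?Ec // [in RHS]extend_step // Eq uD !mulgA; congr (_ *g _).
congr extend; rewrite /euclid_step Ec Eq; congr (_ *g _).
by rewrite mulgA -E12D; congr (E12 _ *g _); ring.
Qed.

Lemma dg_Weyl (a d : F) : a != 0 -> d != 0 ->
  dg a d *g Weyl = Weyl *g dg d a.
Proof.
by move=> a0 d0; apply: GL2P; rewrite !GL2M !dgE // !WeylE; ring.
Qed.

Lemma emb_dgE (a d : F) : a != 0 -> d != 0 ->
  (emb (dg a d) 0 0 = a%:P) * (emb (dg a d) 0 1 = 0) *
  (emb (dg a d) 1 0 = 0) * (emb (dg a d) 1 1 = d%:P).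
Proof. by move=> a0 d0; rewrite !GLmapE !dgE // polyC0. Qed.

Lemma extend_dg (a d : F) x : a != 0 -> d != 0 ->
  extend (emb (dg a d) *g x) = f (dg a d) *g extend x.
Proof.
have [n] := ubnP (szc x); elim: n x a d => // n IH x a d sx a0 d0.
have Ec : (emb (dg a d) *g x) 1 0 = d *: x 1 0.
  by rewrite GL2M !emb_dgE // mul0r add0r mul_polyC.
have Ea : (emb (dg a d) *g x) 0 0 = a *: x 0 0.
  by rewrite GL2M !emb_dgE // mul0r addr0 mul_polyC.
have [c0|c0] := eqVneq (x 1 0) 0.
  have [p0 r0 xp xr] := GL2_upper c0.
  rewrite !extend_upper //; last by rewrite Ec c0 scaler0.
  rewrite Ea !GL2M !emb_dgE // !(mul0r, addr0, add0r) !mul_polyC !coefZ.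
  rewrite mulgA -fM; congr (f _ *g u _).
    by apply: GL2P; rewrite !GL2M !dgE ?mulf_neq0 //; ring.
  by rewrite scalerA invfM mulrAC mulVf // mul1r.
have Ec0 : (emb (dg a d) *g x) 1 0 != 0 by rewrite Ec scaler_eq0 negb_or d0.
have Eq : (emb (dg a d) *g x) 0 0 %/ (emb (dg a d) *g x) 1 0
          = (a / d) *: (x 0 0 %/ x 1 0).
  by rewrite Ea Ec divpZl divpZr // scalerA.
rewrite extend_step // [in RHS]extend_step // Eq.
have -> : euclid_step (emb (dg a d) *g x) = emb (dg d a) *g euclid_step x.
  rewrite /euclid_step Eq !mulgA.
  set k := x 0 0 %/ x 1 0; congr (_ *g _).
  apply: GL2P; rewrite !GL2M !emb_dgE // !WeylVE !E12E -?mul_polyC ?polyCM;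
    try ring.
  have : (d^-1)%:P * d%:P = 1 :> A by rewrite -polyCM mulVf.
  by move=> e; ring: e.
rewrite IH //; last by have := size_euclid_step c0; lia.
rewrite !mulgA fd // -!mulgA; congr (_ *g _).
by rewrite !mulgA -!fM dg_Weyl.
Qed.

(** If the lower entry of the first column has the smaller degree, then
    multiplying by the Weyl element prepends a step with quotient zero to the
    Euclidean algorithm. *)
Lemma extend_Weyl_lt x : (szc x < sza x)%N ->
  extend (Weyl *g x) = f Weyl *g extend x.
Proof.
move=> lt_s.
have Ec : (Weyl *g x) 1 0 = - x 0 0 by rewrite GL2M !WeylE; ring.
have Ea : (Weyl *g x) 0 0 = x 1 0 by rewrite GL2M !WeylE; ring.
have c0 : (Weyl *g x) 1 0 != 0.
  by rewrite Ec oppr_eq0 -size_poly_gt0; lia.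
have Eq : (Weyl *g x) 0 0 %/ (Weyl *g x) 1 0 = 0.
  by apply: divp_small; rewrite Ec Ea size_polyN.
rewrite extend_step // /euclid_step Eq oppr0 E12_0 mul1g mulKg.
by rewrite -fu E12_0 f1 mul1g.
Qed.

Lemma Weyl2 : Weyl *g Weyl = dg (-1) (-1) :> GL2 F.
Proof.
by apply: GL2P; rewrite !GL2M !WeylE !dgE ?oppr_eq0 ?oner_eq0 //; ring.
Qed.

Lemma extend_Weyl x : extend (Weyl *g x) = f Weyl *g extend x.
Proof.
have n10 : -1 != 0 :> F by rewrite oppr_eq0 oner_eq0.
have WWx y : Weyl *g (Weyl *g y) = emb (dg (-1) (-1)) *g y.
  by rewrite mulgA -emb_Weyl -embM Weyl2.
have [lt_s|le_s] := ltnP (szc x) (sza x).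
  exact: extend_Weyl_lt.
(* When the degree of the upper entry is smaller, x = Weyl * y for some y to
   which the previous case applies. *)
have lt_case y : (sza y < szc y)%N ->
  extend (Weyl *g y) = f Weyl *g extend y.
  move=> lt_s; rewrite -{2}[y](mulVKg Weyl).
  rewrite -{1}[y](mulVKg Weyl) WWx extend_dg // extend_Weyl_lt; last first.
    rewrite !GL2M !WeylVE.
    by rewrite !mul0r !mul1r mulN1r add0r addr0 size_polyN.
  by rewrite mulgA -fM Weyl2.
have [|ge_s] := ltnP (sza x) (szc x); first exact: lt_case.
have s_eq : sza x = szc x by apply/eqP; rewrite eqn_leq le_s ge_s.
have c0 : x 1 0 != 0.
  apply/eqP => c0; move: s_eq; rewrite c0 size_poly0 => /eqP.
  rewrite size_poly_eq0 => /eqP a0; have := GL2_det x.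
  by rewrite a0 c0 mul0r mulr0 subr0 unitr0.
have [k k0 Ek] : exists2 k : F, k != 0 & x 0 0 %/ x 1 0 = k%:P.
  have s1 : size (x 0 0 %/ x 1 0) = 1%N.
    rewrite size_divp // s_eq; have : (0 < szc x)%N by rewrite size_poly_gt0.
    lia.
  by have /size_poly1P[k k0 ->] : size (x 0 0 %/ x 1 0) == 1%N; [rewrite s1 | exists k].
(* In the case of equal degrees the quotient is a nonzero constant k, and
   x = E12 k * Weyl * z, where Weyl * E12 k * Weyl is again in the big cell. *)
pose y := E12 (- k%:P) *g x.
pose z := Weyl^-1%g *g y.
have y10 : y 1 0 = x 1 0 by rewrite GL2M !E12E; ring.
have y00 : y 0 0 = x 0 0 %% x 1 0.
  rewrite GL2M !E12E [in LHS](divp_eq (x 0 0) (x 1 0)) Ek; ring.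
have ys : (sza y < szc y)%N by rewrite y10 y00 ltn_modp.
have xE : x = E12 k%:P *g y by rewrite /y mulgA -E12D subrr E12_0 mul1g.
have yE : y = Weyl *g z by rewrite /z mulVKg.
have z00 : z 0 0 = - y 1 0 by rewrite GL2M !WeylVE; ring.
have z10 : z 1 0 = y 0 0 by rewrite GL2M !WeylVE; ring.
clearbody z; clearbody y.
have kV0 : k^-1 != 0 by rewrite invr_eq0.
have nk0 : - k != 0 by rewrite oppr_eq0.
have cell : Weyl *g E12 k *g Weyl
  = E12 (- k^-1) *g Weyl *g dg (- k) (- k^-1) *g E12 (- k^-1) :> GL2 F.
  apply: GL2P; rewrite !GL2M !dgE ?oppr_eq0 // !E12E !WeylE; field => //.
have Ex : Weyl *g x = E12 (- k^-1)%:P *g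
   (Weyl *g (emb (dg (- k) (- k^-1)) *g (E12 (- k^-1)%:P *g z))).
  rewrite xE yE !mulgA; congr (_ *g z).
  have /(congr1 (@emb F)) := cell.
  by rewrite !embM !emb_E12 emb_Weyl.
rewrite Ex extendE12 extend_Weyl_lt; last first.
  rewrite !GL2M !emb_dgE ?oppr_eq0 // !E12E z00 z10.
  rewrite !(mul0r, mul1r, add0r, addr0) !mul_polyC !size_scale ?oppr_eq0 //.
  rewrite size_polyDl ?size_polyN //.
  by rewrite size_scale // oppr_eq0.
rewrite extend_dg ?oppr_eq0 // extendE12 xE extendE12 yE -!fu.
rewrite extend_Weyl_lt ?z00 ?z10 ?size_polyN // !mulgA -!fM.
by rewrite cell !fM.
Qed.

(** [extend] is equivariant under the constant matrices; with [extendE12] this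
    is all that is needed for multiplicativity. *)
Lemma extend_emb g x : extend (emb g *g x) = f g *g extend x.
Proof.
elim/(@GL2_ind_bruhat F): g x => [a d a0 d0|c||g g' IHg IHg'] x.
- exact: extend_dg.
- by rewrite emb_E12 extendE12 fu.
- by rewrite emb_Weyl extend_Weyl.
by rewrite embM -mulgA IHg IHg' fM mulgA.
Qed.

End Extension.

Section GroupMorphism.
Variables (G H : groupType) (p : {multiplicative G -> H}).

Lemma gmor1 : p 1%g = 1%g.
Proof. by apply: (@mulgI _ (p 1%g)); rewrite -gmulfM !mulg1. Qed.

Lemma gmorV x : p x^-1%g = (p x)^-1%g.
Proof. by apply/esym/mulg1_eq; rewrite -gmulfM mulgV gmor1. Qed.

Lemma gmorX x n : p (x ^+ n)%g = (p x ^+ n)%g.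
Proof. by elim: n => [|n IH]; rewrite ?gmor1 // !expgS gmulfM IH. Qed.

End GroupMorphism.

Section Generation.
Variable F : fieldType.
Local Notation A := {poly F}.
Implicit Types (x y : GL2 A) (b c : A).

(** The Euclidean algorithm on the first column, as an induction principle. *)
Lemma euclid_ind (P : GL2 A -> Prop) :
  (forall x, x 1 0 = 0 -> P x) ->
  (forall k x, P x -> P (E12 k *g (Weyl *g x))) -> forall x, P x.
Proof.
move=> P0 PS x; have [n] := ubnP (size (x 1 0)%R).
elim: n x => // n IH x sx; have [/P0 //|c0] := eqVneq (x 1 0) 0.
have -> : x = E12 (x 0 0 %/ x 1 0) *g (Weyl *g euclid_step x).
  by rewrite /euclid_step mulVKg mulgA -E12D subrr E12_0 mul1g.
by apply/PS/IH; have := size_euclid_step c0; lia.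
Qed.

Lemma emb_dg_E12 (a d : F) b : a != 0 -> d != 0 ->
  emb (dg a d) *g E12 b = E12 ((a / d) *: b) *g emb (dg a d).
Proof.
move=> a0 d0; apply: GL2P; rewrite !GL2M !emb_dgE // !E12E; try by ring.
rewrite -mul_polyC !(mul0r, mul1r, mulr0, addr0, add0r).
by rewrite mulrAC -polyCM divfK.
Qed.

Lemma upperE x : x 1 0 = 0 ->
  x = E12 (((x 1 1)`_0)^-1 *: x 0 1) *g emb (dg (x 0 0)`_0 (x 1 1)`_0).
Proof.
move=> c0; have [a0 d0 xa xd] := GL2_upper c0.
apply: GL2P; rewrite !GL2M !emb_dgE // !E12E ?c0; last by rewrite -xd; ring.
- by rewrite -xa; ring.
- by rewrite mulr0 add0r -mul_polyC mulrAC -polyCM mulVf // mul1r.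
by ring.
Qed.

(** Constant and elementary matrices generate [GL2 {poly F}]. *)
Lemma GL2_poly_ind (P : GL2 A -> Prop) :
  P 1%g -> (forall g x, P x -> P (emb g *g x)) ->
  (forall b x, P x -> P (E12 b *g x)) -> forall x, P x.
Proof.
move=> P1 Pg PE; apply: euclid_ind => [x /upperE->|k x Px].
  by apply: PE; rewrite -[emb _]mulg1; apply: Pg.
by apply: PE; rewrite -(emb_Weyl F); apply: Pg.
Qed.

Lemma SL2_poly_ind (P : GL2 A -> Prop) :
  (forall a, a != 0 -> P (emb (dg a a^-1))) ->
  (forall x, \det x = 1 -> P x -> P (Weyl *g x)) ->
  (forall b x, \det x = 1 -> P x -> P (E12 b *g x)) ->
  forall x, \det x = 1 -> P x.
Proof.
move=> Pd PW PE; apply: euclid_ind => [x c0 x1|k x IH].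
  have [a0 d0 xa xd] := GL2_upper c0; rewrite (upperE c0).
  have a_1 : (x 1 1)`_0 = ((x 0 0)`_0)^-1.
    move: x1; rewrite det_mx2 c0 mulr0 subr0 xa xd -polyCM -polyC1 => /polyC_inj.
    by rewrite !coefC /= => e; rewrite -[LHS](mulKf a0) e mulr1.
  apply: PE; rewrite a_1; last exact: Pd.
  by rewrite det_mx2 !emb_dgE ?invr_eq0 // mul0r subr0 -polyCM mulfV.
have dE y b : \det (E12 b *g y) = \det y.
  by rewrite GL2_det_mul det_E12 mul1r.
have dW y : \det (Weyl *g y) = \det y.
  by rewrite GL2_det_mul det_Weyl mul1r.
by rewrite dE dW => d1; apply: PE; rewrite ?dW //; apply: PW => //; apply: IH.
Qed.

Theorem GL2_poly_extension (H : groupType) (f : GL2 F -> H) (u : A -> H) :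
  {morph f : x y / x *g y >-> x *g y} -> {morph u : b c / b + c >-> b *g c} ->
  (forall c : F, f (E12 c) = u c%:P) ->
  (forall (a d : F) b, a != 0 -> d != 0 ->
     f (dg a d) *g u b = u ((a / d) *: b) *g f (dg a d)) ->
  exists Phi : {multiplicative GL2 A -> H},
    (forall g, Phi (emb g) = f g) /\ (forall b, Phi (E12 b) = u b).
Proof.
move=> fM uD fu fd.
have extend1 : extend f u 1%g = 1%g.
  rewrite extend_upper ?GL2_1E // coef1 scaler0 /=.
  rewrite dg11 (f1 fM) mul1g -polyC0 -fu E12_0; exact: f1.
have eg g x : extend f u (emb g *g x) = f g *g extend f u x by exact: extend_emb.
have eE b x : extend f u (E12 b *g x) = u b *g extend f u x by exact: extendE12.
have extendM : {morph extend f u : x y / x *g y >-> x *g y}.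
  move=> x y; elim/GL2_poly_ind: x => [|g x IH|b x IH].
  - by rewrite extend1 !mul1g.
  - by rewrite -mulgA !eg IH mulgA.
  by rewrite -mulgA !eE IH mulgA.
pose Phi : {multiplicative GL2 A -> H} :=
  HB.pack (extend f u) (isMultiplicative.Build _ _ (extend f u) extendM).
exists Phi; split=> [g|b].
  by rewrite -[emb g]mulg1 /= eg extend1 mulg1.
by rewrite -[E12 b]mulg1 /= eE extend1 mulg1.
Qed.

End Generation.

(** * Reiner automorphisms and two families of quotients *)

Section LinearForms.
Variable F : fieldType.
Local Notation A := {poly F}.
Variables (l : A -> F) (ll : scalar l).

Lemma scalarD b c : l (b + c) = l b + l c.
Proof. by rewrite -{1}[b]scale1r ll mul1r. Qed.

Lemma scalar0 : l 0 = 0.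
Proof. by apply: (addrI (l 0)); rewrite -scalarD !addr0. Qed.

Lemma scalarZ a b : l (a *: b) = a * l b.
Proof. by rewrite -[_ *: b]addr0 ll scalar0 addr0. Qed.

Lemma scalarC (c : F) : l c%:P = c * l 1.
Proof. by rewrite -[c%:P]mulr1 mul_polyC scalarZ. Qed.

End LinearForms.

Section Applications.
Variable F : fieldType.
Local Notation A := {poly F}.
Local Notation G := (GL2 A).

Lemma reiner_endo (phi : A -> A) : linear phi -> phi 1 = 1 ->
  exists Psi : {multiplicative G -> G},
    (forall g, Psi (emb g) = emb g) /\ (forall b, Psi (E12 b) = E12 (phi b)).
Proof.
move=> pl p1.
have pD b c : phi (b + c) = phi b + phi c.
  by rewrite -{1}[b]scale1r pl scale1r.
have p0 : phi 0 = 0 by apply: (addrI (phi 0)); rewrite -pD !addr0.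
have pZ a b : phi (a *: b) = a *: phi b by rewrite -[_ *: b]addr0 pl p0 addr0.
apply: GL2_poly_extension.
- exact: embM.
- by move=> b c; rewrite /= pD E12D.
- by move=> c; rewrite emb_E12 /= -[in RHS]alg_polyC pZ p1 alg_polyC.
by move=> a d b a0 d0; rewrite emb_dg_E12 // pZ.
Qed.

(** An [F]-linear automorphism of [{poly F}] fixing [1] extends to an
    automorphism of [GL2 {poly F}] which fixes the constant matrices. *)
Lemma reiner_auto (phi psi : A -> A) : linear phi -> linear psi -> phi 1 = 1 ->
  cancel phi psi -> cancel psi phi ->
  exists Psi : {multiplicative G -> G}, [/\ bijective Psi,
    forall g, Psi (emb g) = emb g & forall b, Psi (E12 b) = E12 (phi b)].
Proof.
move=> pl sl p1 pK sK.
have s1 : psi 1 = 1 by rewrite -{1}p1 pK.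
have [Phi [Pg PE]] := reiner_endo pl p1; have [Psi [Sg SE]] := reiner_endo sl s1.
exists Phi; split=> //; exists Psi.
  apply: (@GL2_poly_ind F (fun x => Psi (Phi x) = x)) => [|g x IH|b x IH].
  - by rewrite !gmor1.
  - by rewrite !gmulfM IH Pg Sg.
  by rewrite !gmulfM IH PE SE pK.
apply: (@GL2_poly_ind F (fun x => Phi (Psi x) = x)) => [|g x IH|b x IH].
- by rewrite !gmor1.
- by rewrite !gmulfM IH Sg Pg.
by rewrite !gmulfM IH SE PE sK.
Qed.

(** The retraction onto the constant matrices attached to a linear form [l]
    with [l 1 = 1]; it is the evaluation at [0] when [l] is. *)
Lemma retraction (l : A -> F) : scalar l -> l 1 = 1 ->
  exists rho : {multiplicative G -> GL2 F},
    (forall g, rho (emb g) = g) /\ (forall b, rho (E12 b) = E12 (l b)).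
Proof.
move=> ll l1; apply: (@GL2_poly_extension F _ id).
- by [].
- by move=> b c; rewrite /= (scalarD ll) E12D.
- by move=> c; rewrite (scalarC ll) l1 mulr1.
by move=> a d b a0 d0; rewrite dg_E12 // (scalarZ ll).
Qed.

(** When all nonzero constants have square [1], a linear form [l] with
    [l 1 = 0] gives a quotient of the affine group of the line, in which the
    constant matrices of determinant one become trivial. *)
Lemma affine_quotient (l : A -> F) :
  (forall a : F, a != 0 -> a ^+ 2 = 1) -> scalar l -> l 1 = 0 ->
  exists rho : {multiplicative G -> GL2 F},
    (forall g, rho (emb g) = dg (\det g) 1) /\
    (forall b, rho (E12 b) = E12 (l b)).
Proof.
move=> sq1 ll l1; have n10 := oner_neq0 F; apply: GL2_poly_extension.
- by move=> g h; rewrite dgM ?GL2F_det // mulr1 GL2_det_mul.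
- by move=> b c; rewrite /= (scalarD ll) E12D.
- by move=> c; rewrite (scalarC ll) l1 mulr0 E12_0 det_E12 dg11.
move=> a d b a0 d0; rewrite dg_E12 ?GL2F_det // (scalarZ ll) dg_det // divr1.
by have -> : d^-1 = d; [rewrite -[LHS]mulr1 -(sq1 _ d0) expr2 mulKf |].
Qed.

End Applications.

(** * Indices of normal subgroups *)

Section Index.
Variables (G : groupType) (N : set G).
Hypothesis Nsub : is_subgroup N.

Definition lcoset g : set G := [set g *g x | x in N]%classic.

Lemma lcosetP g h : lcoset g = lcoset h <-> N (g^-1%g *g h).
Proof.
have [N1 NM NV] := Nsub; split=> [e|Nh].
  have : lcoset h h by exists 1%g; rewrite ?mulg1.
  by rewrite -e => -[n Nn <-]; rewrite mulKg.
apply/seteqP; split=> _ [n Nn <-].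
  exists (h^-1%g *g g *g n); last by rewrite -!mulgA mulVKg.
  by apply: NM => //; rewrite -[h^-1%g *g g]invgK invgM invgK; apply: NV.
exists (g^-1%g *g h *g n); last by rewrite -!mulgA mulVKg.
exact: NM.
Qed.

(** A map separating the cosets of [N] bounds its index. *)
Lemma index_le (Y : finType) (B : {pred Y}) (f : G -> Y) :
  (forall x, f x \in B) -> (forall x y, f x = f y -> N (x^-1%g *g y)) ->
  finite_index N /\ (subgroup_index N <= #|B|)%N.
Proof.
move=> fB fN; pose c y := lcoset (xget 1%g [set g | f g = y]%classic).
have sub : (left_cosets N `<=` [set` [fset C in map c (enum B)]%fset])%classic.
  move=> _ [g ->] /=; rewrite !inE /=; apply/mapP; exists (f g).
    by rewrite mem_enum fB.
  rewrite /c; apply/lcosetP/fN/esym.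
  by have : [set h | f h = f g]%classic g by []; move/(xgetI 1%g).
have fin : finite_index N by apply: sub_finite_set sub _; exact: finite_fset.
split=> //; rewrite /subgroup_index cardE.
rewrite -(size_map c); apply: leq_trans (size_undup _); rewrite -card_fseq.
apply: fsubset_leq_card; apply/fsubsetP => C.
by rewrite in_fset_set // => /set_mem/sub.
Qed.

Lemma index_gt0 : finite_index N -> (0 < subgroup_index N)%N.
Proof.
move=> fin; rewrite cardfs_gt0; apply/fset0Pn; exists (lcoset 1%g).
by rewrite in_fset_set //; apply/mem_set; exists 1%g.
Qed.

Hypothesis Nnorm : forall x g, N x -> N (x ^ g)%g.
Hypothesis Nfin : finite_index N.

(** A finite group acts on the cosets of [N] by translation through a
    homomorphism to [G], and every stabiliser is the preimage of [N]. *)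
Section Translation.
Variables (K : finGroupType) (f : K -> G).
Hypothesis fM : {morph f : x y / (x * y)%g >-> x *g y}.

Let X : finType := fset_set (left_cosets N).

Let inX C : (C \in fset_set (left_cosets N)) = (C \in left_cosets N).
Proof. exact: in_fset_set. Qed.

Let translate (C : X) (k : K) : X :=
  insubd C [set (f k)^-1%g *g x | x in val C]%classic.

Let translateE C k :
  val (translate C k) = [set (f k)^-1%g *g x | x in val C]%classic.
Proof.
rewrite /translate insubdK // -topredE /= inX.
apply/mem_set; have := valP C; rewrite inX => /set_mem[g ->].
exists ((f k)^-1%g *g g).
apply/seteqP; split=> [_ [_ [x Nx <-] <-]|_ [x Nx <-]].
  by exists x; rewrite ?mulgA.
by exists (g *g x); rewrite ?mulgA //; exists x.
Qed.

Let f_1 : f 1%g = 1%g.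
Proof. by apply: (@mulgI _ (f 1%g)); rewrite -fM !mulg1. Qed.

Let translate1 : translate^~ 1%g =1 id.
Proof.
move=> C; apply/val_inj; rewrite translateE f_1 invg1.
by apply/seteqP; split=> [_ [x Cx <-]|x Cx]; [|exists x]; rewrite ?mul1g.
Qed.

Let translateM x : act_morph translate x.
Proof.
move=> a b; apply/val_inj; rewrite !translateE fM invgM.
apply/seteqP; split=> [_ [y Cy <-]|_ [_ [y Cy <-] <-]].
  by exists ((f a)^-1%g *g y); rewrite ?mulgA //; exists y.
by exists y; rewrite ?mulgA.
Qed.

(** All orbits have the index of the preimage of [N] as cardinal, a multiple of
    the index of any larger subgroup [Z]. *)
Lemma index_dvd (Z : {group K}) :
  (forall k, N (f k) -> k \in Z) -> (#|[set: K] : Z|%g %| subgroup_index N)%N.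
Proof.
move=> fZ; pose to := TotalAction translate1 translateM.
have stab C : 'C_[set: K][C | to]%g \subset Z.
  apply/fintype.subsetP => k /finset.setIP[_ /astab1P/= /(congr1 val)].
  rewrite translateE => eC; apply: fZ.
  have := valP C; rewrite inX => /set_mem[g Cg]; move: eC; rewrite Cg.
  have -> : [set (f k)^-1%g *g x | x in [set g *g x | x in N]]%classic
      = lcoset ((f k)^-1%g *g g).
    apply/seteqP; split=> [_ [_ [x Nx <-] <-]|_ [x Nx <-]].
      by exists x; rewrite ?mulgA.
    by exists (g *g x); rewrite ?mulgA //; exists x.
  move/lcosetP; rewrite invgM invgK => /Nnorm -/(_ g^-1%g).
  by rewrite conjgE invgK -!mulgA mulgV mulg1 mulVKg.
have -> : subgroup_index N = #|[set: X]|.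
  by rewrite cardsT /X -cardfE.
have actsX : [acts [set: K], on [set: X] | to].
  by apply/actsP => k _ C; rewrite !inE.
rewrite -(acts_sum_card_orbit actsX); apply: dvdn_sum => _ /finset.imsetP[C _ ->].
by rewrite card_orbit -(Lagrange_index (finset.subsetT Z) (stab C)) dvdn_mulr.
Qed.

End Translation.
End Index.

(** * Normal subgroups with few elementary matrices outside *)

Section NormalSubgroup.
Variable F : fieldType.
Local Notation A := {poly F}.
Local Notation G := (GL2 A).
Variable N : set G.
Hypothesis Nn : is_normal_subgroup N.
Implicit Types (x y n : G) (b c : A).

Lemma normal1 : N 1%g. Proof. by case: Nn => -[]. Qed.

Lemma normalM x y : N x -> N y -> N (x *g y).
Proof. by case: Nn => -[_ M _] _; exact: M. Qed.

Lemma normalV x : N x -> N x^-1%g.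
Proof. by case: Nn => -[_ _ V] _; exact: V. Qed.

Lemma normalJ x g : N x -> N (g *g x *g g^-1%g).
Proof.
by case: Nn => _ J /(J _ g^-1%g); rewrite conjgE invgK mulgA.
Qed.

Lemma normal_mull x y : N x -> N (x *g y) -> N y.
Proof. by move=> /normalV Nx Nxy; rewrite -[y](mulKg x); apply: normalM. Qed.

(** A factor in [N] on the left of [x] does not affect the coset of [x]. *)
Lemma normal_mid y n x : N n -> N (y^-1%g *g x) -> N (y^-1%g *g (n *g x)).
Proof.
move=> Nn' Nyx; rewrite -[n *g x](mulVKg x) mulgA; apply: normalM => //.
by have := normalJ x^-1%g Nn'; rewrite invgK mulgA.
Qed.

(** The set of upper right entries of the elementary matrices in [N]; the next
    lemmas show that it is an [F]-subspace. *)
Definition quasi_level b := N (E12 b).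
Local Notation V := quasi_level.

Lemma levelD b c : V b -> V c -> V (b + c).
Proof. by rewrite /V E12D; apply: normalM. Qed.

Lemma levelN b : V b -> V (- b).
Proof. by rewrite /V -E12V; apply: normalV. Qed.

Lemma levelZ a b : V b -> V (a *: b).
Proof.
have [->|a0 Vb] := eqVneq a 0; first by rewrite scale0r /V E12_0 => _; apply: normal1.
have := normalJ (emb (dg a 1)) Vb; rewrite emb_dg_E12 ?oner_eq0 // mulgK divr1.
by [].
Qed.

Lemma levelC (c : F) : V 1 -> V c%:P.
Proof. by move=> V1; rewrite -alg_polyC; apply: levelZ. Qed.

Lemma level1_SL2 (g : GL2 F) : V 1 -> \det g = 1 -> N (emb g).
Proof.
move=> V1; have big (h : GL2 F) : h 1 0 != 0 -> \det h = 1 -> N (emb h).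
  rewrite det_mx2 => c0 h1.
  have -> : h = E12 ((h 0 0 - 1) / h 1 0) *g
                (Weyl *g E12 (- h 1 0) *g Weyl^-1%g) *g
                E12 ((h 1 1 - 1) / h 1 0).
    have e : h 0 1 * h 1 0 = h 0 0 * h 1 1 - 1 by rewrite -h1 subKr.
    have {e}e01 : h 0 1 = (h 0 0 * h 1 1 - 1) / h 1 0 by rewrite -e mulfK.
    apply: GL2P; rewrite !GL2M !E12E !WeylE !WeylVE ?e01;
    move: (h 0 0) (h 1 0) (h 1 1) c0 => p r s c0; by field.
  rewrite !embM !emb_E12.
  apply: normalM; last exact: levelC.
  apply: normalM; first exact: levelC.
  by rewrite embV; apply/normalJ/levelC.
have NW : N Weyl.
  rewrite -(emb_Weyl F); apply: big.
    by rewrite WeylE oppr_eq0 oner_eq0.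
  exact: det_Weyl.
move=> g1; have [c0|c0] := eqVneq (g 1 0) 0; last exact: big.
apply: (normal_mull NW); rewrite -(emb_Weyl F) -embM; apply: big.
  rewrite GL2M !WeylE mul0r addr0 mulN1r oppr_eq0; apply/eqP => a0.
  by move/eqP: g1; rewrite det_mx2 a0 c0 mul0r mulr0 subr0 eq_sym oner_eq0.
by rewrite GL2_det_mul g1 mulr1 det_Weyl.
Qed.

(** Conjugation by the diagonal matrix of [a] and its inverse, which lies in
    [N], multiplies upper right entries by [a ^+ 2]. *)
Lemma level1_full (a : F) b : a != 0 -> a ^+ 2 != 1 -> V 1 -> V b.
Proof.
move=> a0 a2 V1; have a20 : a ^+ 2 - 1 != 0 by rewrite subr_eq0.
have -> : b = (a ^+ 2 - 1)^-1 *: ((a ^+ 2) *: b - b).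
  have -> : a ^+ 2 *: b - b = (a ^+ 2 - 1) *: b by rewrite scalerBl scale1r.
  by rewrite scalerA mulVf // scale1r.
have Nd : N (emb (dg a a^-1)).
  by apply: level1_SL2 => //; rewrite dg_det ?invr_eq0 // mulfV.
apply: levelZ; rewrite /V E12D.
have -> : E12 (a ^+ 2 *: b) = emb (dg a a^-1) *g E12 b *g (emb (dg a a^-1))^-1%g.
  by rewrite emb_dg_E12 ?invr_eq0 // invrK mulgK.
rewrite -!mulgA; apply: normalM => //; rewrite -E12V mulgA.
exact/normalJ/normalV.
Qed.

Lemma level_full_SL2 x : V 1 -> (forall b, V b) -> \det x = 1 -> N x.
Proof.
move=> V1 Vb; apply: SL2_poly_ind => [a a0|y _|b y _].
- by apply: level1_SL2 => //; rewrite dg_det ?invr_eq0 // mulfV.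
- apply: normalM; rewrite -(emb_Weyl F); apply: level1_SL2 => //.
  exact: det_Weyl.
exact/normalM/Vb.
Qed.

(** If the elementary matrices in [N] are at least those in the kernel of one of
    the two kinds of quotients attached to a linear form, then [N] contains that
    kernel, since these matrices generate it as a normal subgroup. *)
Section Kernel.
Variable l : A -> F.
Hypothesis ll : scalar l.
Hypothesis lV : forall b, l b = 0 -> V b.

Lemma retraction_ker (rho : {multiplicative G -> GL2 F}) x : l 1 = 1 ->
  (forall g, rho (emb g) = g) -> (forall b, rho (E12 b) = E12 (l b)) ->
  rho x = 1%g -> N x.
Proof.
move=> l1 rg rE.
suff main y : N ((emb (rho y))^-1%g *g y).
  by move=> r1; have := main x; rewrite r1 emb1 invg1 mul1g.
elim/GL2_poly_ind: y => [|g y IH|b y IH].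
- by rewrite gmor1 emb1 invg1 mul1g; apply: normal1.
- by rewrite gmulfM rg embM invgM -mulgA mulKg.
rewrite gmulfM rE embM emb_E12 /= invgM E12V -mulgA.
rewrite [E12 _ *g (_ *g _)]mulgA -E12D; apply: normal_mid => //.
by apply: lV; rewrite (scalarD ll) -polyCN (scalarC ll) l1; ring.
Qed.

Lemma affine_ker (rho : {multiplicative G -> GL2 F}) x u0 : l 1 = 0 -> l u0 = 1 ->
  (forall g, rho (emb g) = dg (\det g) 1) ->
  (forall b, rho (E12 b) = E12 (l b)) -> rho x = 1%g -> N x.
Proof.
move=> l1 lu rg rE.
have V1 : V 1 by apply: lV.
have n10 := oner_neq0 F.
(* a section of rho over the affine group *)
pose s (a b : F) : G := E12 (b *: u0) *g emb (dg a 1).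
suff main y : exists a b : F, [/\ a != 0, rho y = E12 b *g dg a 1
                            & N ((s a b)^-1%g *g y)].
  have [a [b [a0 -> Nsx]] e] := main x.
  have a1 : a = 1.
    by have := congr1 (fun g : GL2 F => g 0 0) e;
       rewrite GL2M !dgE // !E12E GL2_1E mulr0 addr0 mul1r.
  have b0 : b = 0.
    by have := congr1 (fun g : GL2 F => g 0 1) e;
       rewrite GL2M !dgE // !E12E GL2_1E mulr0 add0r mulr1.
  by move: Nsx; rewrite /s a1 b0 scale0r E12_0 dg11 emb1 mulg1 invg1 mul1g.
elim/GL2_poly_ind: y => [|g y [a [b [a0 ry Ny]]]|c y [a [b [a0 ry Ny]]]].
- exists (1 : F), (0 : F); split=> //; first by rewrite gmor1 E12_0 dg11 mulg1.
  by rewrite /s scale0r E12_0 dg11 emb1 !mulg1 invg1; apply: normal1.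
- have e0 := GL2F_det g; set e := \det g in e0 *.
  exists (e * a), (e * b); split; first exact: mulf_neq0.
    by rewrite gmulfM rg ry mulgA dg_E12 // divr1 -mulgA dgM // mulr1.
  have -> : s (e * a) (e * b) = emb (dg e 1) *g s a b.
    rewrite /s mulgA emb_dg_E12 // divr1 -mulgA -embM dgM // mulr1.
    by rewrite scalerA.
  have -> : g = dg e 1 *g ((dg e 1)^-1%g *g g) by rewrite mulVKg.
  rewrite invgM embM -!mulgA mulKg.
  apply: normal_mid => //; apply: level1_SL2 => //.
  apply: (mulfI e0); rewrite mulr1 -{1}[e]mulr1 -(dg_det e0 n10) -GL2_det_mul.
  by rewrite mulVKg.
exists a, (l c + b); split=> //; first by rewrite gmulfM rE ry E12D mulgA.
have -> : s a (l c + b) = E12 (l c *: u0) *g s a b.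
  by rewrite /s scalerDl E12D mulgA.
rewrite invgM E12V -mulgA [E12 _ *g (_ *g _)]mulgA -E12D.
apply: normal_mid => //; apply: lV.
by rewrite (scalarD ll) -scaleNr (scalarZ ll) lu; ring.
Qed.

End Kernel.
End NormalSubgroup.

(** * Genuine subgroups miss two elementary directions *)

Section Twist.
Variable F : fieldType.
Local Notation A := {poly F}.
Local Notation G := (GL2 A).
Implicit Types (l : A -> F).

(** A shear of [{poly F}] along [u] carries the form [l0] to the form [l], so
    the quotients attached to these forms differ by an automorphism. *)
Lemma reiner_twist l l0 u : scalar l -> scalar l0 -> l u = 1 -> l0 u = 1 ->
  l 1 = l0 1 ->
  exists Psi : {multiplicative G -> G}, bijective Psi /\
    forall (H : groupType) (f : F -> H) (rho rho0 : {multiplicative G -> H}),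
      (forall g, rho (emb g) = rho0 (emb g)) ->
      (forall b, rho (E12 b) = f (l b)) -> (forall b, rho0 (E12 b) = f (l0 b)) ->
      forall x, rho0 (Psi x) = rho x.
Proof.
move=> ll l0l lu l0u l1.
pose sh (m m0 : A -> F) (b : A) := b + (m b - m0 b) *: u.
have sh_lin m m0 : scalar m -> scalar m0 -> linear (sh m m0).
  move=> ml m0l a b c; rewrite /sh ml m0l scalerDr scalerA addrACA -scalerDl.
  by congr (_ + _ *: u); ring.
have shK m m0 : scalar m -> scalar m0 -> m u = 1 -> m0 u = 1 ->
    cancel (sh m m0) (sh m0 m).
  move=> ml m0l mu m0u b; rewrite /sh !(scalarD ml) !(scalarD m0l).
  rewrite (scalarZ ml) (scalarZ m0l) mu m0u -addrA -scalerDl.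
  by rewrite [X in X *: u](_ : _ = 0) ?scale0r ?addr0 //; ring.
have sh1 : sh l l0 1 = 1 by rewrite /sh l1 subrr scale0r addr0.
have [Psi [Pbij Pg PE]] := reiner_auto (sh_lin _ _ ll l0l) (sh_lin _ _ l0l ll)
  sh1 (shK _ _ ll l0l lu l0u) (shK _ _ l0l ll l0u lu).
exists Psi; split=> // H f rho rho0 rg rE r0E.
elim/GL2_poly_ind => [|g x IH|b x IH].
- by rewrite !gmor1.
- by rewrite !gmulfM IH Pg rg.
rewrite !gmulfM IH PE rE r0E; congr (f _ *g _).
by rewrite /sh (scalarD l0l) (scalarZ l0l) l0u; ring.
Qed.

Lemma common_nonzero l l0 b b0 : scalar l -> scalar l0 -> l b != 0 -> l0 b0 != 0 ->
  exists u, l u != 0 /\ l0 u != 0.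
Proof.
move=> ll l0l lb l0b.
have [lb0|] := eqVneq (l b0) 0; last by exists b0.
have [l0b1|] := eqVneq (l0 b) 0; last by exists b.
by exists (b + b0); rewrite (scalarD ll) (scalarD l0l) lb0 l0b1 addr0 add0r.
Qed.

(** A reduction of the Rademacher function. When [F] has two or three elements,
    it is an additive character of the special linear group of [F], with value
    [b] at [E12 b]. *)
Definition chi (g : GL2 F) : F :=
  (1 - g 1 0 ^+ 2) * (g 0 1 * g 1 1) + g 1 0 * (g 0 0 + g 1 1 - 3%:R).

Hypothesis sq1 : forall a : F, a != 0 -> a ^+ 2 = 1.

Lemma chi_E12 b (g : GL2 F) : \det g = 1 -> chi (E12 b *g g) = b + chi g.
Proof.
rewrite det_mx2 /chi !GL2M !E12E !(mul0r, mul1r, add0r).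
have := sq1; move: (g 0 0) (g 0 1) (g 1 0) (g 1 1) => a b' c d sq det1.
suff e : (1 - c ^+ 2) * d ^+ 2 + c ^+ 2 = 1.
  by transitivity (b * ((1 - c ^+ 2) * d ^+ 2 + c ^+ 2)
    + ((1 - c ^+ 2) * (b' * d) + c * (a + d - 3%:R))); [ring | rewrite e mulr1].
have [c0|/sq->] := eqVneq c 0; last by rewrite subrr mul0r add0r.
have d0 : d != 0 by apply/eqP => d0; move/eqP: det1;
  rewrite c0 d0 !mulr0 subrr eq_sym oner_eq0.
by rewrite (sq _ d0) c0; ring.
Qed.

Lemma chi_Weyl (g : GL2 F) : \det g = 1 -> chi (Weyl *g g) = chi g + 3%:R.
Proof.
rewrite det_mx2 /chi !GL2M !WeylE !(mul0r, mul1r, add0r, mulN1r, addr0).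
have := sq1; move: (g 0 0) (g 0 1) (g 1 0) (g 1 1) => a b c d sq det1.
(* The hypothesis on squares means that 6 = 0 and that a nonzero element is 1
   or -1. *)
have six : 6%:R = 0 :> F.
  have [e|/sq e] := eqVneq (2%:R : F) 0.
    by transitivity (2%:R * 3%:R : F); [ring | rewrite e mul0r].
  by transitivity (2%:R * (2%:R ^+ 2 - 1) : F); [ring | rewrite e subrr mulr0].
have pm (x : F) : x != 0 -> x = 1 \/ x = -1.
  by move=> x0; have /eqP := sq _ x0; rewrite sqrf_eq1 => /orP[] /eqP; [left | right].
have bc : b * c = a * d - 1 by rewrite -det1; ring.
have [c0|c0] := eqVneq c 0.
  have ad : a * d = 1 by apply/eqP; rewrite -subr_eq0 -bc c0 mulr0.
  have a0 : a != 0 by apply/eqP => a0; move/eqP: ad; rewrite a0 mul0r eq_sym oner_eq0.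
  have da : d = a by rewrite -[d](mulKf a0) ad mulr1 -[LHS]mulr1 -(sq _ a0) expr2 mulKf.
  rewrite c0 da; case: (pm _ a0) => ->; first by ring.
  by transitivity (b * - 1 + 3%:R - 6%:R); [ring | rewrite six; ring].
have bE : b = c * (a * d - 1) by rewrite -bc mulrCA -expr2 (sq _ c0) mulr1.
have a01 : a = 0 \/ a = 1 \/ a = -1.
  by have [->|/pm] := eqVneq a 0; [left | right].
case: (pm _ c0) bE => -> ->; case: a01 => [|[]] ->; try ring.
  by transitivity (- d + 6%:R); [rewrite six; ring | ring].
by transitivity (- d + 7%:R - 2%:R * 6%:R); [ring | rewrite six; ring].
Qed.

End Twist.

Section GenuineSubgroup.
Variable F : finFieldType.
Local Notation A := {poly F}.
Local Notation G := (GL2 A).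

Lemma horner_scalar (c : F) : scalar (fun b : A => b.[c]).
Proof. by move=> a b b'; rewrite hornerD hornerZ. Qed.

(** The difference of the values at [1] and [0]: a linear form which vanishes on
    the constants and on an ideal. *)
Definition val_diff (b : A) : F := b.[1] - b.[0].

Lemma val_diff_scalar : scalar val_diff.
Proof. by move=> a b b'; rewrite /val_diff !hornerD !hornerZ; ring. Qed.

Lemma det_evalGL (c : F) (x : G) : \det (evalGL c x) = (\det x).[c].
Proof. by rewrite !det_mx2 !evalGLE !hornerE. Qed.

(** On matrices of determinant one, the homomorphism attached to [val_diff] only
    depends on the matrix modulo ['X * ('X - 1)]. *)
Lemma affine_quotient_chi (rho : {multiplicative G -> GL2 F}) :
  (forall a : F, a != 0 -> a ^+ 2 = 1) ->
  (forall g, rho (emb g) = dg (\det g) 1) ->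
  (forall b, rho (E12 b) = E12 (val_diff b)) ->
  forall x : G, \det x = 1 ->
    rho x = E12 (chi (evalGL 1 x) - chi (evalGL 0 x)).
Proof.
move=> sq1 rg rE; have addK3 (p r s : F) : p + s - (r + s) = p - r by ring.
have ev1 c (x : G) : \det x = 1 -> \det (evalGL c x) = 1.
  by rewrite det_evalGL => ->; rewrite hornerC.
apply: SL2_poly_ind => [a a0|x x1 IH|b x x1 IH].
- by rewrite !evalGL_emb subrr rg dg_det ?invr_eq0 // mulfV // dg11 E12_0.
- rewrite gmulfM IH !evalGLM !evalGL_Weyl.
  rewrite !chi_Weyl ?ev1 // [X in _ = E12 X]addK3.
  by rewrite -(emb_Weyl F) rg det_Weyl dg11 mul1g.
rewrite gmulfM IH rE !evalGLM !evalGL_E12.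
rewrite !chi_E12 ?ev1 // -E12D /val_diff; congr E12; ring.
Qed.

Section Genuine.
Variable N : set G.
Hypothesis Nn : is_normal_subgroup N.
Hypothesis Ngen : genuine_non_congruence_subgroup N.

(** No automorphism carries [N] to a subgroup containing a nontrivial [Gamma]. *)
Lemma genuine_absurd (Psi : {multiplicative G -> G}) (I : set A) b :
  bijective Psi -> is_ideal I -> I b -> b != 0 ->
  ~ (forall y, Gamma I y -> exists2 x, N x & Psi x = y).
Proof.
move=> Pbij Iid Ib b0 sub; case: Ngen => _ _ /(_ Psi Pbij)[Ns _ nc]; apply: nc.
split=> //; exists I; split=> //.
by move=> I0; move: Ib b0; rewrite I0 /= => ->; rewrite eqxx.
Qed.

Lemma bij_surj (T : Type) (p : T -> T) : bijective p -> forall y, exists x, p x = y.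
Proof. by case=> r _ rK y; exists (r y). Qed.

(** Otherwise [N] would contain [SL2], which is [Gamma] of the unit ideal. *)
Lemma genuine_not_full : ~ (N (E12 1) /\ forall b, N (E12 b)).
Proof.
case=> V1 Vb; have Pb : bijective (idfun : G -> G) by exists id.
pose Psi : {multiplicative G -> G} :=
  HB.pack (idfun : G -> G) (isMultiplicative.Build G G idfun (fun _ _ => erefl)).
apply: (@genuine_absurd Psi [set: A]%classic 1) => //; first exact: oner_neq0.
by move=> y [y1 _]; exists y => //; apply: level_full_SL2.
Qed.

Lemma genuine_elementary1 (a : F) : a != 0 -> a ^+ 2 != 1 -> ~ N (E12 1).
Proof.
by move=> a0 a2 N1; apply: genuine_not_full; split=> // b; apply: level1_full a2 _.
Qed.

(** The case where the elementary matrices in [N] have codimension one: by a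
    Reiner automorphism one may replace the linear form defining them by a
    form for which the quotient is a congruence quotient. *)
Lemma genuine_not_hyperplane (l : A -> F) b1 : scalar l -> l b1 != 0 ->
  ~ (forall b, l b = 0 -> N (E12 b)).
Proof.
move=> ll lb1 lV.
have scale_form (c : F) : scalar (fun b => l b / c).
  by move=> a b b'; rewrite ll mulrDl mulrA.
have lV' c b : c != 0 -> l b / c = 0 -> N (E12 b).
  by move=> c0 /eqP; rewrite mulf_eq0 invr_eq0 (negPf c0) orbF => /eqP/lV.
have [l1|l1] := eqVneq (l 1) 0.
  have N1 : N (E12 1) by apply: lV.
  have sq1 (a : F) : a != 0 -> a ^+ 2 = 1.
    by move=> a0; apply/eqP/negPn/negP => a2; apply: (genuine_elementary1 a0 a2).
  have vX : val_diff 'X != 0 by rewrite /val_diff !hornerX subr0 oner_eq0.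
  have [u [lu vu]] := common_nonzero ll val_diff_scalar lb1 vX.
  (* rescaled so that both forms take the value 1 at u' *)
  pose u' := (val_diff u)^-1 *: u.
  pose l' b := l b / l u'.
  have lu' : l u' != 0 by rewrite (scalarZ ll) mulf_neq0 // invr_eq0.
  have l'l : scalar l' by apply: scale_form.
  have l'u : l' u' = 1 by rewrite /l' mulfV.
  have vu' : val_diff u' = 1 by rewrite (scalarZ val_diff_scalar) mulVf.
  have l'1 : l' 1 = 0 by rewrite /l' l1 mul0r.
  have v1 : val_diff 1 = 0 by rewrite /val_diff !hornerC subrr.
  have [|Psi [Pbij tw]] := reiner_twist l'l val_diff_scalar l'u vu'.
    by rewrite l'1 v1.
  have [rho [rg rE]] := affine_quotient sq1 l'l l'1.
  have [rho0 [r0g r0E]] := affine_quotient sq1 val_diff_scalar v1.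
  have tw' := tw _ (@E12 F) rho rho0 _ rE r0E.
  apply: (@genuine_absurd Psi [set b : A | b.[0] = 0 /\ b.[1] = 0]%classic
           ('X * ('X - 1%:P))) => //.
  - split=> /= [|b c [b0 b1'] [c0 c1]|b c [c0 c1]].
    + by rewrite !hornerC.
    + by rewrite !hornerD b0 b1' c0 c1 addr0.
    by rewrite !hornerM c0 c1 !mulr0.
  - by rewrite /= !hornerE; split; ring.
  - by rewrite mulf_neq0 ?polyX_eq0 ?polyXsubC_eq0.
  move=> y [y1 Iy]; have [x Pxy] := bij_surj Pbij y; exists x => //.
  apply: (affine_ker Nn l'l _ l'1 l'u rg rE) => [b|].
    exact: lV'.
  rewrite -tw'; last by move=> g; rewrite rg r0g.
  rewrite Pxy (affine_quotient_chi sq1 r0g r0E y1).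
  have ev c : c = 0 \/ c = 1 -> evalGL c y = 1%g.
    move=> c01; have Iyc i j : (y i j).[c] = ((1%:M : 'M[A]_2) i j).[c].
      have [e0 e1] := Iy i j; apply/eqP; rewrite -subr_eq0.
      rewrite -hornerN -hornerD; move: e0 e1; rewrite !mxE.
      by case: c01 => -> e0 e1; rewrite ?e0 ?e1.
    by apply: GL2P; rewrite evalGLE Iyc !mxE /= ?hornerC.
  by rewrite !ev ?subrr ?E12_0 //; [left | right].
(* Here the form may be replaced by the evaluation at 0. *)
pose l' b := l b / l 1.
have l'l : scalar l' by apply: scale_form.
have l'1 : l' 1 = 1 by rewrite /l' mulfV.
have h0l := horner_scalar 0.
have h1 : (1 : A).[0] = 1 by rewrite hornerC.
have [|Psi [Pbij tw]] := reiner_twist l'l h0l l'1 h1; first by rewrite l'1 h1.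
have [rho [rg rE]] := retraction l'l l'1.
have [rho0 [r0g r0E]] := retraction h0l h1.
have tw' := tw _ (@E12 F) rho rho0 _ rE r0E.
apply: (@genuine_absurd Psi [set b : A | b.[0] = 0]%classic 'X) => //.
- split=> /= [|b c b0 c0|b c c0].
  + by rewrite !hornerC.
  + by rewrite !hornerD b0 c0 addr0.
  by rewrite !hornerM c0 !mulr0.
- by rewrite /= hornerX.
- by rewrite polyX_eq0.
move=> y [y1 Iy]; have [x Pxy] := bij_surj Pbij y; exists x => //.
apply: (retraction_ker Nn l'l _ l'1 rg rE) => [b|]; first exact: lV'.
rewrite -tw'; last by move=> g; rewrite rg r0g.
have -> : rho0 (Psi x) = evalGL 0 y.
  rewrite Pxy; elim/GL2_poly_ind: {y1 Iy Pxy} y => [|g y IH|b y IH].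
  - by rewrite gmor1; apply: GL2P; rewrite evalGLE !GL2_1E hornerC.
  - by rewrite gmulfM IH r0g evalGLM evalGL_emb.
  by rewrite gmulfM IH r0E evalGLM evalGL_E12.
have Iy0 i j : (y i j).[0] = ((1%:M : 'M[A]_2) i j).[0].
  by have /= := Iy i j; rewrite !mxE !hornerE => /eqP; rewrite subr_eq0 => /eqP.
by apply: GL2P; rewrite evalGLE Iy0 !mxE /= ?hornerC.
Qed.

(** If any two elements were dependent modulo the subspace of the [b] with
    [N (E12 b)], then this subspace would be everything or the kernel of a
    nonzero linear form, which the previous lemmas exclude. *)
Theorem genuine_independent : exists b1 b2 : A,
  forall x y : F, N (E12 (x *: b1 + y *: b2)) -> x = 0 /\ y = 0.
Proof.
apply: contrapT => dep.
have [[b1 Nb1]|full] := pselect (exists b1, ~ N (E12 b1)); last first.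
  have Vb b : N (E12 b) by apply: contrapT => Nb; apply: full; exists b.
  by apply: genuine_not_full; split.
have VZ := levelZ Nn; have VD := levelD Nn; rewrite /quasi_level in VZ VD.
have coefP b : exists c : F, N (E12 (b - c *: b1)).
  apply: contrapT => nc; apply: dep; exists b1, b => x y Nxy.
  have [y0|y0] := eqVneq y 0.
    split=> //; apply/eqP/negPn/negP => x0; apply: Nb1.
    have := VZ x^-1 _ Nxy.
    by rewrite y0 scale0r addr0 scalerA mulVf // scale1r.
  case: nc; exists (- (x / y)); have := VZ y^-1 _ Nxy.
  by rewrite scalerDr !scalerA mulVf // scale1r scaleNr opprK addrC mulrC.
have [l lP] := choice coefP.
have uniq b c : N (E12 (b - c *: b1)) -> c = l b.
  move=> Nc; apply/eqP/negPn/negP => cl; apply: Nb1.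
  have c0 : l b - c != 0 by rewrite subr_eq0 eq_sym.
  have := VZ (l b - c)^-1 _ (VD _ _ Nc (levelN Nn (lP b))).
  have -> : b - c *: b1 - (b - l b *: b1) = (l b - c) *: b1.
    by rewrite scalerBl opprB addrC addrA subrK.
  by rewrite scalerA mulVf // scale1r.
have ll : scalar l.
  move=> a b c; apply/esym/uniq.
  have -> : a *: b + c - (a * l b + l c) *: b1
     = a *: (b - l b *: b1) + (c - l c *: b1).
    by rewrite scalerBr scalerA scalerDl opprD addrACA.
  by apply: VD => //; apply: VZ.
apply: (@genuine_not_hyperplane l b1 ll).
  rewrite -(uniq b1 1) ?oner_neq0 // scale1r subrr E12_0; exact: normal1.
by move=> b lb; have := lP b; rewrite lb scale0r subr0.
Qed.

End Genuine.
End GenuineSubgroup.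

(** * Divisibility of the index *)

Section FiniteGL2.
Variable F : finFieldType.

(** The two descriptions of [GL2] of a finite field. *)
Definition of_GL (g : {'GL_2[F]}) : GL2 F := MkGL2 (GL_unitmx g).

Fact to_GL_proof (g : GL2 F) : (g : 'M[F]_2) \is a GRing.unit.
Proof. exact: GL2valP. Qed.

Definition to_GL (g : GL2 F) : {'GL_2[F]} := FinRing.Unit (to_GL_proof g).

Lemma of_GLK : cancel of_GL to_GL.
Proof. by move=> g; apply/val_inj. Qed.

Lemma to_GLK : cancel to_GL of_GL.
Proof. by move=> g; apply/val_inj. Qed.

Lemma of_GLM : {morph of_GL : x y / (x * y)%g >-> x *g y}.
Proof. by by move=> x y; apply/val_inj. Qed.

Lemma GL2_commE12 (g : GL2 F) : g *g E12 1 = E12 1 *g g ->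
  g 1 0 = 0 /\ g 0 0 = g 1 1.
Proof.
move=> e; have e00 := congr1 (fun h : GL2 F => h 0 0) e.
have e01 := congr1 (fun h : GL2 F => h 0 1) e; move: e00 e01.
rewrite /= !GL2M !E12E !(mulr0, mulr1, mul1r, mul0r, addr0, add0r).
rewrite addrC => e00 e01; split.
  by apply: (addIr (g 0 0)); rewrite add0r -e00.
by apply: (addIr (g 0 1)); rewrite e01 addrC.
Qed.

Lemma scalar_central (g : {'GL_2[F]}) : let h := of_GL g in
  (h 0 1 = 0 /\ h 1 0 = 0 /\ h 0 0 = h 1 1) <-> (g \in 'Z('GL_2[F])%g).
Proof.
split=> [[h01 [h10 hd]]|].
  apply/centerP; split; first by rewrite inE.
  move=> k _; apply: (can_inj of_GLK); rewrite !of_GLM.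
  by apply: GL2P; rewrite !GL2M ?h01 ?h10 ?hd; ring.
case/centerP => _ gc; set h := of_GL g.
have hc (k : GL2 F) : h *g k = k *g h.
  by rewrite -[k]to_GLK -!of_GLM gc // inE.
clearbody h; have [h10 hd] := GL2_commE12 (hc (E12 1)); split=> //.
have : (h *g Weyl) 0 0 = (Weyl *g h) 0 0 by rewrite hc.
rewrite !GL2M !WeylE h10 => /eqP.
by rewrite !mulr0 mul0r !add0r mulrN1 oppr_eq0 => /eqP.
Qed.

Lemma card_center_GL2 : #|'Z('GL_2[F])%g| = #|F|.-1.
Proof.
rewrite -card_finField_unit.
pose sc (a : {unit F}) : {'GL_2[F]} := to_GL (dg (val a) (val a)).
have a0 (a : {unit F}) : val a != 0 by rewrite -unitfE; exact: valP.
have sc_inj : injective sc.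
  move=> a b /(can_inj to_GLK)/(congr1 (fun h : GL2 F => h 0 0)).
  by rewrite /= !(dgE (a0 _) (a0 _)) => /val_inj.
rewrite -(card_imset _ sc_inj); apply: eq_card => g.
apply/idP/finset.imsetP => [/scalar_central[h01 [h10 hd]]|[a _ ->]].
  have D := GL2_det (of_GL g).
  have u : of_GL g 0 0 \is a GRing.unit.
    by move: D; rewrite h01 hd mul0r subr0 unitrM => /andP[].
  exists (FinRing.Unit u); first by rewrite inE.
  apply: (can_inj of_GLK); rewrite to_GLK.
  have g0 : of_GL g 0 0 != 0 by rewrite -unitfE.
  by apply: GL2P; rewrite !(dgE g0 g0) // -hd.
by apply/scalar_central; rewrite to_GLK !(dgE (a0 _) (a0 _)).
Qed.

Lemma card_PGL2_index : card_PGL2 F = #|'GL_2[F] : 'Z('GL_2[F])|%g.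
Proof. by rewrite /card_PGL2 card_quotient // gFnorm. Qed.

Lemma card_PGL2E : card_PGL2 F = (#|F| * (#|F| ^ 2 - 1))%N.
Proof.
have q1 := card_finNzRing_gt1 F; have q0 : (0 < #|F|.-1)%N.
  by rewrite -subn1 subn_gt0.
rewrite card_PGL2_index; apply/eqP; rewrite -(eqn_pmul2l q0).
rewrite -{1}card_center_GL2 Lagrange ?center_sub // card_GL_2.
by apply/eqP; move: q1; case: #|F| => // n _; rewrite /=; nia.
Qed.

End FiniteGL2.

Section Divisibility.
Variable F : finFieldType.
Local Notation A := {poly F}.
Local Notation G := (GL2 A).
Variable N : set G.
Hypothesis Nn : is_normal_subgroup N.

(** The hypothesis says that [x] is the commutator of [d] and [k]. *)
Lemma normal_commutator (x k d : G) : x *g (k *g d) = d *g k -> N k -> N x.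
Proof.
move=> e Nk; have -> : x = d *g k *g d^-1%g *g k^-1%g.
  by rewrite -e !mulgA !mulgK.
apply: (normalM Nn); [exact: normalJ | exact: normalV].
Qed.

(** If [N] contains a constant matrix which is not scalar, and some nonzero [a]
    has [a ^+ 2 != 1], then [N] contains [E12 1]: after a conjugation the matrix
    moves a coordinate vector to a multiple of the other one, and two
    commutators finish. *)
Lemma nonscalar_elementary (a : F) (h : GL2 F) : a != 0 -> a ^+ 2 != 1 ->
  N (emb h) -> ~ (h 0 1 = 0 /\ h 1 0 = 0 /\ h 0 0 = h 1 1) -> N (E12 1).
Proof.
move=> a0 a2 Nh nsc.
pose M := [set g : GL2 F | N (emb g)]%classic.
have MJ g k : M k -> M (g *g k *g g^-1%g).
  move=> Mk; rewrite /M /= !embM.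
  by rewrite embV; apply: normalJ.
have Mcomm x k d : x *g (k *g d) = d *g k -> M k -> M x.
  by move=> e; apply: (@normal_commutator _ _ (emb d)); rewrite -!embM e.
have n10 := oner_neq0 F.
have [h1 Mh1 c0] : exists2 h1, M h1 & h1 1 0 != 0.
  have W k : M k -> k 0 1 != 0 -> exists2 h1, M h1 & h1 1 0 != 0.
    move=> Mk b0; exists (Weyl *g k *g Weyl^-1%g); first exact: MJ.
    rewrite !GL2M !WeylE !WeylVE !(mul0r, mulr0, mulr1, addr0, add0r).
    by rewrite mulN1r oppr_eq0.
  have [c0|c0] := eqVneq (h 1 0) 0; last by exists h.
  have [b0|b0] := eqVneq (h 0 1) 0; last exact: (W h).
  apply: (W (E12 1 *g h *g (E12 1)^-1%g)); first exact: MJ.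
  rewrite E12V !GL2M !E12E b0 c0; apply/eqP => e; apply: nsc; split=> //; split=> //.
  by apply/esym/eqP; rewrite -subr_eq0 -e; apply/eqP; ring.
pose s := - (h1 0 0 / h1 1 0).
pose k := E12 s *g h1 *g (E12 s)^-1%g.
have Mk : M k by apply: MJ.
have k00 : k 0 0 = 0.
  by rewrite /k E12V !GL2M !E12E /s; move: (h1 0 0) (h1 1 0) c0 => p r r0; field.
have kbc : k 0 1 != 0.
  have := GL2_det k; rewrite k00 mul0r sub0r unitfE oppr_eq0 mulf_eq0 negb_or.
  by case/andP.
clearbody k; clear Mh1.
(* m is the lower left entry of the commutator of dg a 1 and k *)
pose m := - (k 1 1 * (a^-1 - 1)) / k 0 1.
have kapE : a * a^-1 - 0 * m \is a GRing.unit.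
  by rewrite mul0r subr0 mulfV // unitr1.
have Mkap : M (gl a 0 m a^-1).
  apply: (Mcomm _ k (dg a 1)) => //.
  apply: GL2P; rewrite !GL2M !dgE // !glE // k00 /m;
    move: (k 0 1) (k 1 0) (k 1 1) kbc => b c t b0; by field; rewrite ?a0 ?b0.
pose s1 := a^-1 ^+ 2 - 1.
have s10 : s1 != 0 by rewrite subr_eq0 exprVn invr_eq1.
have lowE r : 1 * 1 - 0 * r \is a @GRing.unit F by rewrite mul0r subr0 mulr1 unitr1.
have Mlow : M (gl 1 0 s1 1).
  have := Mkap; set kap := gl _ _ _ _ => {}Mkap.
  have e : gl 1 0 s1 1 *g (gl 1 0 1 1 *g kap) = kap *g gl 1 0 1 1.
    by apply: GL2P; rewrite !GL2M !glE // /s1; field.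
  have -> : gl 1 0 s1 1 = kap *g (gl 1 0 1 1 *g kap^-1%g *g (gl 1 0 1 1)^-1%g).
    by rewrite !mulgA -e !mulgA !mulgK.
  rewrite /M /= embM; apply: normalM => //; apply: MJ.
  by rewrite /M /= embV; apply: normalV.
have := MJ Weyl _ Mlow.
have -> : Weyl *g gl 1 0 s1 1 *g Weyl^-1%g = E12 (- s1).
  by apply: GL2P; rewrite !GL2M !E12E !WeylE !WeylVE !glE //; ring.
rewrite /M /= emb_E12 => /(levelZ Nn (- s1)^-1).
by rewrite -mul_polyC -polyCM mulVf ?oppr_eq0.
Qed.

Hypothesis Nfin : finite_index N.

Lemma PGL2_dvd_index (a : F) : a != 0 -> a ^+ 2 != 1 -> ~ N (E12 1) ->
  (card_PGL2 F %| subgroup_index N)%N.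
Proof.
move=> a0 a2 N1; rewrite card_PGL2_index.
have [Ns Nnorm] := Nn.
apply: (@index_dvd _ N Ns Nnorm Nfin _ (fun g => emb (of_GL g))).
  by move=> x y; rewrite of_GLM embM.
move=> g Ng; apply/scalar_central; apply: contrapT => nsc.
exact/N1/(nonscalar_elementary a0 a2 Ng).
Qed.

Lemma square_dvd_index (b1 b2 : A) :
  (forall x y : F, N (E12 (x *: b1 + y *: b2)) -> x = 0 /\ y = 0) ->
  (#|F| ^ 2 %| subgroup_index N)%N.
Proof.
move=> indep; have [Ns Nnorm] := Nn.
have := @index_dvd _ N Ns Nnorm Nfin (F * F)%type
  (fun v => E12 (v.1 *: b1 + v.2 *: b2)) _ 1%G.
rewrite indexg1 cardsT card_prod mulnn; apply.
  by move=> v w; rewrite /= !scalerDl addrACA E12D.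
by move=> [x y] /indep[/= -> ->]; rewrite inE.
Qed.

End Divisibility.

(** Otherwise [0], [1] and [-1] would be all the elements of [F]. *)
Lemma exists_sqr_neq1 (F : finFieldType) : (3 < #|F|)%N ->
  exists2 a : F, a != 0 & a ^+ 2 != 1.
Proof.
move=> q3; apply: contrapT => no.
have sq (a : F) : a != 0 -> a ^+ 2 == 1.
  by move=> a0; apply/negPn/negP => a2; apply: no; exists a.
suff : (#|F| <= 3)%N by rewrite leqNgt q3.
have sub : {subset F <= [:: 0; 1; -1 : F]}.
  move=> a _; rewrite !inE; have [//|/sq/=] := eqVneq a 0.
  by rewrite sqrf_eq1.
rewrite cardE; apply: (@uniq_leq_size F (enum F) [:: 0; 1; -1]).
  exact: enum_uniq.
by move=> a _; apply: sub.
Qed.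

Theorem genuine_index_dvd (F : finFieldType) (N : set (GL2 {poly F})) :
  is_normal_subgroup N -> genuine_non_congruence_subgroup N ->
  ((if (3 < #|F|)%N then #|F| * card_PGL2 F else #|F| ^ 2) %| subgroup_index N)%N.
Proof.
move=> Nn Ng; have [_ Nfin _] := Ng.
have [b1 [b2 indep]] := genuine_independent Nn Ng.
have d2 := square_dvd_index Nn Nfin indep.
have [q3|//] := ltnP 3 #|F|.
have [a a0 a2] := exists_sqr_neq1 q3.
have := PGL2_dvd_index Nn Nfin a0 a2 (genuine_elementary1 Nn Ng a0 a2).
rewrite card_PGL2E mulnA mulnn => dP.
rewrite Gauss_dvd ?d2 /=; first exact: dvdn_trans (dvdn_mull _ (dvdnn _)) dP.
by rewrite subn1 coprimenP // expn_gt0 (leq_trans _ q3).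
Qed.

(** * Squares of units modulo an ideal of polynomials *)

Section FiniteFieldPolynomials.
Variable F : finFieldType.
Local Notation A := {poly F}.
Local Notation q := #|F|.

Lemma polyD_expq (b c : A) : (b + c) ^+ q = b ^+ q + c ^+ q.
Proof.
have [p p_pr pF] := finPcharP F.
apply: exprDn_pchar; rewrite (eq_pnat _ (pchar_poly F)) (eq_pnat _ (pcharf_eq pF)).
by rewrite -cardsT; have := abelem_pgroup (fin_ring_pchar_abelem pF).
Qed.

(** The product of the monic polynomials of degree one. *)
Definition linear_product : A := 'X^q - 'X.
Local Notation z := linear_product.

Lemma size_linear_product : size z = q.+1.
Proof.
rewrite /z size_polyDl ?size_polyXn //.
by rewrite size_polyN size_polyX ltnS; apply: card_finNzRing_gt1.
Qed.

(** The powers of [b] modulo [g] are eventually periodic, so one of them is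
    idempotent. *)
Lemma idempotent_power (g b : A) : g != 0 ->
  exists m w, (0 < m)%N /\ (b ^+ m) ^+ 2 = b ^+ m + g * w.
Proof.
move=> g0.
pose f (n : 'I_(#|{ffun 'I_(size g) -> F}|).+1) : {ffun 'I_(size g) -> F} :=
  [ffun i : 'I_(size g) => ((b ^+ n) %% g)`_i].
have : ~~ injectiveb f.
  by apply/negP => /injectiveP/leq_card; rewrite card_ord ltnn.
case/injectivePn => i [j ij /ffunP fij].
have modE : (b ^+ i) %% g = (b ^+ j) %% g.
  apply/polyP => k; have [lt_k|le_k] := ltnP k (size g).
    by have := fij (Ordinal lt_k); rewrite !ffunE.
  by rewrite !nth_default //; apply: leq_trans le_k; rewrite ltnW // ltn_modp.
wlog lt_ij : i j ij {fij} modE / (i < j)%N.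
  move=> wl; have [lt_ij|lt_ji|/val_inj e] := ltngtP i j; first exact: wl lt_ij.
    by apply: wl lt_ji; rewrite // eq_sym.
  by rewrite e eqxx in ij.
have [d d0 dE] : exists2 d, (0 < d)%N & j = (i + d)%N :> nat.
  by exists (j - i)%N; lia.
have [u eij] : exists u, b ^+ j = b ^+ i + g * u.
  exists ((b ^+ j) %/ g - (b ^+ i) %/ g).
  have := divp_eq (b ^+ i) g; have := divp_eq (b ^+ j) g; rewrite modE.
  by set v := _ %/ g; set v' := _ %/ g; set r := _ %% g => -> ->; ring.
have step k : exists w, b ^+ (i + k + d) = b ^+ (i + k) + g * w.
  by exists (u * b ^+ k); rewrite addnAC -dE !exprD eij; ring.
have steps k n : exists w, b ^+ (i + k + n * d) = b ^+ (i + k) + g * w.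
  elim: n => [|n [w IH]]; first by exists 0; rewrite mul0n addn0 mulr0 addr0.
  have [w' e] := step (k + n * d)%N; exists (w + w').
  by rewrite mulSn [(d + _)%N]addnC !addnA -[(i + k + _)%N]addnA e addnA IH; ring.
have [k kE] : exists k, (d * i.+1 = i + k)%N.
  by exists (d * i.+1 - i)%N; nia.
exists (d * i.+1)%N; have [w e] := steps k i.+1; exists w; split; first by lia.
rewrite -exprM (_ : (d * i.+1 * 2 = i + k + i.+1 * d)%N); last by rewrite -kE; lia.
by rewrite e kE.
Qed.

Section SquaresOfUnits.
Variables (J : A -> Prop) (g : A).
Hypothesis JD : forall a b, J a -> J b -> J (a + b).
Hypothesis JM : forall a b : A, J b -> J (a * b).
Hypothesis g0 : g != 0.
Hypothesis Jg : J g.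
Hypothesis Junit : forall x x' y : A, x * x' = 1 + g * y -> J (x ^+ (2 * q) - x ^+ 2).

Let J0 : J 0. Proof. by rewrite -(mul0r g); apply: JM. Qed.
Let JN a : J a -> J (- a). Proof. by rewrite -mulN1r; apply: JM. Qed.
Let JB a b : J a -> J b -> J (a - b). Proof. by move=> Ja /JN; apply: JD. Qed.

(** If [x ^+ (2 * q)] and [x ^+ 2] agree modulo [J] for every unit [x] modulo
    [g], then [J] contains the square of [linear_product]. The quotient ring by
    [g] is a product, with [linear_product] invertible in one factor and
    nilpotent in the other one; [s] is the idempotent of the first factor. *)
Lemma linear_product_sqr : J (z ^+ 2).
Proof.
have [m [w [m0 sE]]] := idempotent_power z g0.
move: sE; move sz: (z ^+ m) => s sE.
have Js : J (s ^+ 2 - s) by rewrite sE addrAC subrr add0r mulrC; apply: JM.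
have sD : s * s - s = g * w by rewrite -expr2 sE [s + _]addrC addrK.
have powE (v : A) n : J ((1 - s + s * v) ^+ n - (1 - s + s * v ^+ n)).
  elim: n => [|n IH].
    by rewrite !expr0 (_ : _ - _ = 0); [exact: J0 | ring].
  rewrite exprS (_ : _ - _ = (1 - s + s * v) *
    ((1 - s + s * v) ^+ n - (1 - s + s * v ^+ n)) +
    (1 - v - v ^+ n + v * v ^+ n) * (s ^+ 2 - s)); last by rewrite exprS; ring.
  by apply: JD; apply: JM.
have powE' (v : A) n : J ((s + (1 - s) * v) ^+ n - (s + (1 - s) * v ^+ n)).
  elim: n => [|n IH].
    by rewrite !expr0 (_ : _ - _ = 0); [exact: J0 | ring].
  rewrite exprS (_ : _ - _ = (s + (1 - s) * v) *
    ((s + (1 - s) * v) ^+ n - (s + (1 - s) * v ^+ n)) +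
    (1 - v - v ^+ n + v * v ^+ n) * (s ^+ 2 - s)); last by rewrite exprS; ring.
  by apply: JD; apply: JM.
have sqE (v : A) : v ^+ (2 * q) = (v ^+ q) ^+ 2 by rewrite mulnC exprM.
(* The factor where z is invertible: there t and t + 1 are units. *)
have big (v v' : A) : z = v * v' -> J (s * ((v ^+ q) ^+ 2 - v ^+ 2)).
  move=> zE; have [r rv] : exists r, r * v = s.
    exists (z ^+ m.-1 * v').
    by rewrite -mulrA [v' * v]mulrC -zE -exprSr prednK.
  have Ju : J ((1 - s + s * v) ^+ (2 * q) - (1 - s + s * v) ^+ 2).
    apply: (@Junit _ (1 - s + s * r) (w * (2%:R + s - v - r))).
    rewrite (_ : _ * _ = 1 + (s * s - s) * (2%:R + s - v - r)
                         + s * s * (r * v - s)); last by ring.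
    by rewrite rv sD subrr mulr0 addr0 mulrA.
  have := JB (JD Ju (powE v 2)) (powE v (2 * q)%N); congr J.
  by rewrite (sqE v); move: (_ ^+ (2 * q)) (v ^+ q) => X V; ring.
have JX : J (s * (('X^q) ^+ 2 - 'X ^+ 2)).
  apply: (big 'X ('X^(q.-1) - 1)).
  by rewrite mulrBr mulr1 -exprS prednK // ltnW // card_finNzRing_gt1.
have JX1 : J (s * (('X^q + 1) ^+ 2 - ('X + 1) ^+ 2)).
  rewrite -[X in 'X^q + X](expr1n A q) -polyD_expq.
  apply: (big _ (('X + 1) ^+ q.-1 - 1)).
  rewrite mulrBr mulr1 -exprS prednK ?(ltnW (card_finNzRing_gt1 F)) //.
  by rewrite polyD_expq expr1n /z; ring.
have Jsz : J (s * z ^+ 2).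
  have J2 : J (2%:R * (s * z)).
    by have := JB JX1 JX; congr J; rewrite /z; ring.
  have := JB JX (JM 'X J2); congr J; rewrite /z; ring.
(* The factor where z is nilpotent: there 1 + z is a unit. *)
have q2 : q = q.-2.+2.
  by have := card_finNzRing_gt1 F; case: #|F| => [|[]].
have Ju : J ((1 - s) * ((1 + z ^+ q) ^+ 2 - (1 + z) ^+ 2)).
  have [r [e rz]] : exists r e, (1 + z) * r = 1 - e * s.
    exists (\sum_(i < m) (- z) ^+ i), ((-1) ^+ m).
    rewrite -sz -exprMn mulN1r -[RHS]opprB subrX1.
    by move: (\sum_(i < m) _) => S; ring.
  have Jx : J ((s + (1 - s) * (1 + z)) ^+ (2 * q) - (s + (1 - s) * (1 + z)) ^+ 2).
    apply: (@Junit _ (s + (1 - s) * r) (w * (2%:R - (1 + z + r) + e - e * s))).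
    rewrite (_ : _ * _ = 1 + (s * s - s) * (2%:R - (1 + z + r) + e - e * s)
       + (1 - s) ^+ 2 * ((1 + z) * r - (1 - e * s))); last by ring.
    by rewrite rz sD subrr mulr0 addr0 mulrA.
  have := JB (JD Jx (powE' (1 + z) 2)) (powE' (1 + z) (2 * q)%N); congr J.
  rewrite (sqE (1 + z)) polyD_expq expr1n.
  by move: (_ ^+ (2 * q)) (z ^+ q) => X V; ring.
(* The nilpotent z is cancelled by descending induction on its exponent. *)
have desc (c : F) k : c != 0 -> J ((1 - s) * (z ^+ 2 * (c%:P + z * k))) ->
    J ((1 - s) * z ^+ 2).
  move=> c0 Jc; suff main n j : (m <= j + n)%N -> J ((1 - s) * z ^+ (j + 2)).
    by apply: (main m 0%N).
  elim: n j => [|n IH] j le_m.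
    rewrite (_ : (j + 2 = m + (j + 2 - m))%N); last by lia.
    rewrite exprD sz (_ : _ * _ = - z ^+ (j + 2 - m) * (s ^+ 2 - s)).
      exact: JM.
    by move: (z ^+ _) => Z; ring.
  have J3 : J ((1 - s) * z ^+ (j.+1 + 2)) by apply: IH; lia.
  have := JM (c^-1%:P) (JB (JM (z ^+ j) Jc) (JM k J3)); congr J.
  have cV : c^-1%:P * c%:P = 1 :> A by rewrite -polyCM mulVf.
  transitivity ((c^-1%:P * c%:P) * ((1 - s) * z ^+ (j + 2))).
    rewrite addSn (exprS _ (j + 2)) exprD.
    by move: (z ^+ j) c%:P c^-1%:P => Z C D; ring.
  by rewrite cV mul1r.
have Jnz : J ((1 - s) * z ^+ 2).
  have zq : z ^+ q = z * (z * z ^+ q.-2) by rewrite {1}q2 !exprS.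
  move: Ju; rewrite zq; move: (z ^+ q.-2) => y Ju.
  have [two0|two0] := eqVneq (2%:R : F) 0.
    apply: (@desc (-1) (z * y ^+ 2)); first by rewrite oppr_eq0 oner_eq0.
    have two0A : 2%:R = 0 :> A by rewrite -polyC_natr two0.
    have := JD Ju J0; congr J; rewrite polyCN.
    transitivity ((1 - s) * (z ^+ 2 * (- 1 + z * (z * y ^+ 2)))
                  + (1 - s) * (2%:R * (z * (z * y) - z))).
      by ring.
    by rewrite two0A mul0r mulr0 addr0.
  apply: (@desc (- 2%:R) (2%:R * y + (z * y - 1) * (z * y + 1))).
    by rewrite oppr_eq0.
  have := JM z Ju; congr J; rewrite polyCN polyC_natr.
  by ring.
by have := JD Jsz Jnz; congr J; ring.
Qed.

End SquaresOfUnits.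
End FiniteFieldPolynomials.

(** * Automorphisms and elementary matrices *)

Section Unipotent.
Variable F : finFieldType.
Local Notation A := {poly F}.
Local Notation G := (GL2 A).
Variables (p : nat) (pF : p \in [pchar F]).
Implicit Types (u v h : G).

Let pA : p \in [pchar A]. Proof. by rewrite pchar_poly. Qed.

Lemma expp_eq1 (a : A) : a ^+ p = 1 -> a = 1.
Proof.
move=> ap; apply/eqP; rewrite -subr_eq0; apply/eqP.
have : (a - 1) ^+ p = 0.
  have := pFrobenius_autB_comm pA (mulrC a 1).
  by rewrite !pFrobenius_autE ap expr1n subrr.
by move/eqP; rewrite expf_eq0 => /andP[_ /eqP].
Qed.

Lemma E12_expp b : (E12 b ^+ p)%g = 1%g :> G.
Proof. by rewrite E12X -mulr_natr (pcharf0 pA) mulr0 E12_0. Qed.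

(** In characteristic [p], an element of exponent [p] is unipotent. *)
Lemma pexp_det0 u : (u ^+ p)%g = 1%g -> \det ((u : 'M[A]_2) - 1) = 0.
Proof.
move=> up; have pM : p \in [pchar 'M[A]_2].
  have /andP[p_pr /eqP p0] := pA; apply/andP; split=> //.
  by rewrite -(rmorph_nat (@scalar_mx A 2)) p0 raddf0.
have valX n : ((u ^+ n)%g : 'M[A]_2) = (u : 'M[A]_2) ^+ n.
  elim: n => [//|n IH]; rewrite expgS exprS -IH; reflexivity.
have : ((u : 'M[A]_2) - 1) ^+ p = 0.
  have c : GRing.comm (u : 'M[A]_2) 1 by rewrite /GRing.comm mulr1 mul1r.
  have := pFrobenius_autB_comm pM c.
  by rewrite !pFrobenius_autE expr1n -valX up subrr.
set M := _ - 1 => Mp.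
have detX n : \det (M ^+ n) = (\det M) ^+ n.
  by elim: n => [|n IH]; rewrite ?expr0 ?det1 // !exprS -IH -det_mulmx.
have : (\det M) ^+ p = 0.
  by rewrite -detX Mp det_mx2 !mxE mul0r subrr.
by move/eqP; rewrite expf_eq0 => /andP[_ /eqP].
Qed.

(** A singular matrix kills a vector with coprime entries. *)
Lemma singular_kernel (M : 'M[A]_2) : \det M = 0 ->
  exists a c s r : A, [/\ a * s + c * r = 1, M 0 0 * a + M 0 1 * c = 0
                        & M 1 0 * a + M 1 1 * c = 0].
Proof.
rewrite det_mx2 => M0.
have [a' [c' [nz e0 e1]]] : exists a' c' : A, [/\ (a' != 0) || (c' != 0),
    M 0 0 * a' + M 0 1 * c' = 0 & M 1 0 * a' + M 1 1 * c' = 0].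
  have [M00|n00] := eqVneq (M 0 0) 0; last first.
    exists (- M 0 1), (M 0 0); split; rewrite ?n00 ?orbT //; first by ring.
    by rewrite -[RHS]M0; ring.
  have [M01|n01] := eqVneq (M 0 1) 0; last first.
    exists (- M 0 1), (M 0 0); split; rewrite ?oppr_eq0 ?n01 //; first by ring.
    by rewrite -[RHS]M0; ring.
  have [M10|n10] := eqVneq (M 1 0) 0; last first.
    by exists (- M 1 1), (M 1 0); split; rewrite ?n10 ?orbT // ?M00 ?M01; ring.
  by exists 1, 0; split; rewrite ?oner_eq0 // ?M00 ?M01 ?M10; ring.
have := coprimep_div_gcd nz; set g := gcdp a' c'.
have ga : a' = a' %/ g * g by rewrite divpK // dvdp_gcdl.
have gc : c' = c' %/ g * g by rewrite divpK // dvdp_gcdr.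
have g0 : g != 0 by rewrite gcdp_eq0 negb_and.
move=> /Bezout_eq1_coprimepP[[s r] /= b1].
exists (a' %/ g), (c' %/ g), s, r; split; first by rewrite -b1; ring.
  by apply: (mulIf g0); rewrite mulrDl -!mulrA -ga -gc e0 mul0r.
by apply: (mulIf g0); rewrite mulrDl -!mulrA -ga -gc e1 mul0r.
Qed.

Lemma upper_exp v n : v 1 0 = 0 -> (v ^+ n)%g 1 0 = 0 /\
  (v ^+ n)%g 0 0 = v 0 0 ^+ n /\ (v ^+ n)%g 1 1 = v 1 1 ^+ n.
Proof.
move=> c0; elim: n => [|n [e10 [e00 e11]]].
  by rewrite expg0 !GL2_1E !expr0.
by rewrite expgS !GL2M e10 e00 e11 c0 !exprS; split; [|split]; ring.
Qed.

(** An element of exponent [p] fixes a vector with coprime entries, which is the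
    first column of a matrix of determinant one. *)
Lemma pexp_conj u : (u ^+ p)%g = 1%g ->
  exists h b, u = h *g E12 b *g h^-1%g.
Proof.
move=> up; have [a [c [s [r [b1 e0 e1]]]]] := singular_kernel (pexp_det0 up).
have k0 : u 0 0 * a + u 0 1 * c = a.
  apply/eqP; rewrite -subr_eq0 -[X in _ == X]e0 !mxE /=; apply/eqP; ring.
have k1 : u 1 0 * a + u 1 1 * c = c.
  apply/eqP; rewrite -subr_eq0 -[X in _ == X]e1 !mxE /=; apply/eqP; ring.
pose h : G := gl a (- r) c s.
have hu : a * s - (- r) * c \is a GRing.unit.
  by rewrite (_ : _ - _ = 1) ?unitr1 // -b1; ring.
have h'u : s * a - r * (- c) \is a GRing.unit.
  by rewrite (_ : _ - _ = 1) ?unitr1 // -b1; ring.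
have hV : h^-1%g = gl s r (- c) a.
  apply/mulg1_eq/GL2P; rewrite !GL2M !glE // ?GL2_1E -?b1; ring.
pose v := h^-1%g *g u *g h.
have vE : u = h *g v *g h^-1%g by rewrite /v !mulgA mulgK mulgV mul1g.
have v00 : v 0 0 = 1.
  rewrite /v -mulgA GL2M [(u *g h) 0 0]GL2M [(u *g h) 1 0]GL2M hV !glE //.
  by rewrite k0 k1 -b1; ring.
have v10 : v 1 0 = 0.
  rewrite /v -mulgA GL2M [(u *g h) 0 0]GL2M [(u *g h) 1 0]GL2M hV !glE //.
  by rewrite k0 k1; ring.
have vp : (v ^+ p)%g = 1%g.
  have -> : v = (u ^ h)%g by rewrite conjgE /v mulgA.
  by rewrite -conjXg up conj1g.
have [_ [_]] := upper_exp p v10; rewrite vp GL2_1E => /esym/expp_eq1 v11.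
exists h, (v 0 1); rewrite [LHS]vE; congr (_ *g _ *g _).
by apply: GL2P; rewrite !E12E.
Qed.

Lemma pexp_centralizer v b : b != 0 -> (v ^+ p)%g = 1%g ->
  v *g E12 b = E12 b *g v -> v = E12 (v 0 1).
Proof.
move=> b0 vp e.
have e00 : (v *g E12 b) 0 0 = (E12 b *g v) 0 0 by rewrite e.
have e01 : (v *g E12 b) 0 1 = (E12 b *g v) 0 1 by rewrite e.
move: e00 e01; rewrite !GL2M !E12E !(mulr0, mulr1, mul1r, addr0) => e00 e01.
have v10 : v 1 0 = 0.
  apply: (mulfI b0); rewrite mulr0; apply: (addrI (v 0 0)).
  by rewrite -e00 addr0.
have v01 : v 0 0 = v 1 1.
  by apply: (mulIf b0); apply: (addIr (v 0 1)); rewrite e01 addrC mulrC.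
have [_ [+ _]] := upper_exp p v10; rewrite vp GL2_1E => /esym/expp_eq1 v00.
by apply: GL2P; rewrite !E12E // -?v01.
Qed.

End Unipotent.

(** Every automorphism carries the group of elementary matrices [E12 b] to one
    of its conjugates: in characteristic [p], it is the set of the elements of
    exponent [p] commuting with [E12 1], and an element of exponent [p] is
    conjugate to an elementary matrix. *)
Theorem automorphism_E12 (F : finFieldType)
    (Phi : {multiplicative GL2 {poly F} -> GL2 {poly F}}) :
  bijective Phi ->
  exists (h : GL2 {poly F}) (theta : {poly F} -> {poly F}),
    (forall b, Phi (E12 b) = h *g E12 (theta b) *g h^-1%g) /\
    (forall c, exists b, theta b = c).
Proof.
move=> Pbij; have Pinj := bij_inj Pbij; have [p p_pr pF] := finPcharP F.
have Pp b : (Phi (E12 b) ^+ p)%g = 1%g by rewrite -gmorX E12_expp // gmor1.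
have [h [b1 e1]] := pexp_conj pF (Pp 1).
have b10 : b1 != 0.
  apply/eqP => b10; have : E12 1 = E12 0 :> GL2 {poly F}.
    by apply: Pinj; rewrite e1 b10 E12_0 gmor1 mulg1 mulgV.
  by move/E12_inj/eqP; rewrite oner_eq0.
have conjK (x : GL2 {poly F}) : h *g (h^-1%g *g x *g h) *g h^-1%g = x.
  by rewrite !mulgA mulgK mulgV mul1g.
have thetaP b : exists c, Phi (E12 b) = h *g E12 c *g h^-1%g.
  pose v := h^-1%g *g Phi (E12 b) *g h.
  have vp : (v ^+ p)%g = 1%g.
    have -> : v = (Phi (E12 b) ^ h)%g by rewrite conjgE /v mulgA.
    by rewrite -conjXg Pp conj1g.
  exists (v 0 1); rewrite -(pexp_centralizer pF b10 vp) ?conjK //.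
  have E1 : E12 b1 = h^-1%g *g Phi (E12 1) *g h by rewrite e1 !mulgA mulVg mul1g mulgVK.
  rewrite E1 /v !mulgA !mulgK -[_ *g _ *g Phi _]mulgA -[X in _ = X *g h]mulgA.
  by rewrite -!gmulfM -!E12D addrC.
have [theta thE] := choice thetaP.
exists h, theta; split=> // c.
have [Psi PhiK PsiK] := Pbij.
pose y := Psi (h *g E12 c *g h^-1%g).
have yp : (y ^+ p)%g = 1%g.
  apply: Pinj; rewrite gmorX gmor1 PsiK.
  have -> : h *g E12 c *g h^-1%g = (E12 c ^ h^-1)%g.
    by rewrite conjgE invgK mulgA.
  by rewrite -conjXg E12_expp // conj1g.
have yc : y *g E12 1 = E12 1 *g y.
  apply: Pinj; rewrite !gmulfM PsiK e1 !mulgA !mulgVK; congr (_ *g _).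
  by rewrite -!mulgA -!E12D addrC.
have yE := pexp_centralizer pF (oner_neq0 _) yp yc.
exists (y 0 1); apply: E12_inj; apply: (@mulgI _ h); apply: (@mulIg _ h^-1%g).
by rewrite -thE -yE PsiK.
Qed.

(** * A normal genuine non-congruence subgroup *)

Section Image.
Variables (G : groupType) (Psi : {multiplicative G -> G}) (N : set G).
Hypotheses (Ns : is_subgroup N) (Nfin : finite_index N).

Lemma image_subgroup : is_subgroup [set Psi x | x in N]%classic.
Proof.
have [N1 NM NV] := Ns; split.
- by exists 1%g; rewrite ?gmor1.
- by move=> _ _ [x Nx <-] [y Ny <-]; exists (x *g y); rewrite ?gmulfM //; apply: NM.
by move=> _ [x Nx <-]; exists x^-1%g; rewrite ?gmorV //; apply: NV.
Qed.

Lemma image_finite_index : bijective Psi ->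
  finite_index [set Psi x | x in N]%classic.
Proof.
move=> Pbij; apply: sub_finite_set
  (finite_image (fun C : set G => [set Psi x | x in C]%classic) Nfin).
move=> _ [g ->]; have [x Px] := bij_surj Pbij g.
exists [set x *g y | y in N]%classic; first by exists x.
apply/seteqP; split=> [_ [_ [y Ny <-] <-]|_ [_ [y Ny <-] <-]].
  by exists (Psi y); [exists y | rewrite gmulfM Px].
by exists (x *g y); [exists y | rewrite gmulfM Px].
Qed.

End Image.

Lemma ideal_nonzero (R : comNzRingType) (I : set R) :
  is_ideal I -> I <> [set 0]%classic -> exists2 g, I g & g != 0.
Proof.
move=> [I0 _ _] nz; apply: contrapT => no; apply: nz.
apply/seteqP; split=> [b Ib|_ ->//]; apply: contrapT => b0; apply: no.
by exists b => //; apply/eqP.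
Qed.

Lemma Gamma_E12 (F : finFieldType) (I : set {poly F}) g b :
  is_ideal I -> I g -> Gamma I (E12 (g * b)).
Proof.
move=> [I0 _ IM] Ig; split.
  exact: det_E12.
move=> a c; case: (ord2P a) => ->; case: (ord2P c) => ->;
  rewrite mxE [X in I (_ + X)]mxE [X in I (_ - X)]mxE !E12E /= ?subrr ?subr0 //.
by rewrite mulrC; apply: IM.
Qed.

Section CommonKernel.
Variables (F : finFieldType) (n : nat).
Local Notation A := {poly F}.
Local Notation G := (GL2 A).
Variable rho : 'I_n -> {multiplicative G -> GL2 F}.

(** The intersection of the kernels of finitely many homomorphisms. *)
Definition common_kernel : set G := [set x | forall i, rho i x = 1%g]%classic.
Local Notation N := common_kernel.

Lemma common_kernel_normal : is_normal_subgroup N.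
Proof.
split; first split.
- by move=> i; rewrite gmor1.
- by move=> x y Nx Ny i; rewrite gmulfM Nx Ny mulg1.
- by move=> x Nx i; rewrite gmorV Nx invg1.
by move=> x g Nx i; rewrite conjgE !gmulfM Nx mul1g gmorV mulVg.
Qed.

Lemma common_kernel_finite : finite_index N.
Proof.
have [Ns _] := common_kernel_normal.
have := @index_le _ N Ns {ffun 'I_n -> 'M[F]_2} predT
  (fun x => [ffun i => rho i x : 'M[F]_2]) (fun _ => isT).
case=> // x y e i; rewrite gmulfM gmorV (_ : rho i x = rho i y) ?mulVg //.
by apply/val_inj; move/ffunP/(_ i): e; rewrite !ffunE.
Qed.

Variable l : 'I_n -> A -> F.
Hypothesis ll : forall i, scalar (l i).
Hypothesis rhoE : forall i b, rho i (E12 b) = E12 (l i b).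
Hypothesis l_surj : forall v : 'I_n -> F, exists b, forall i, l i b = v i.

(** A unit [x] modulo [g] with inverse [x'] gives a matrix [D] of determinant one
    congruent modulo [g] to the diagonal matrix of [x] and [x']. Conjugation by
    it multiplies the entry of an elementary matrix by [x ^+ 2] modulo [g]. *)
Lemma diagonal_modulo (g x x' y : A) : x * x' = 1 + g * y ->
  exists D : G, forall (I : set A) b, is_ideal I -> I g ->
    Gamma I (D *g E12 b *g D^-1%g *g E12 (- (x ^+ 2 * b))).
Proof.
move=> e; pose eps := - (g * y); have xe : x * x' = 1 - eps by rewrite opprK.
have u : (x + x * eps) * x' - (- eps) * eps \is a GRing.unit.
  rewrite (_ : _ - _ = 1) ?unitr1 //.
  transitivity ((x * x') * (1 + eps) + eps * eps); first by ring.
  by rewrite xe; ring.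
have u' : x' * (x + x * eps) - eps * (- eps) \is a GRing.unit.
  by rewrite mulrC [eps * _]mulrC.
exists (gl (x + x * eps) (- eps) eps x') => I b [I0 ID IM] Ig; set D := gl _ _ _ _.
have DV : D^-1%g = gl x' eps (- eps) (x + x * eps).
  apply/mulg1_eq/GL2P; rewrite !GL2M !glE // ?GL2_1E; try by ring.
    transitivity ((x * x') * (1 + eps) + eps * eps); first by ring.
    by rewrite xe; ring.
  transitivity ((x * x') * (1 + eps) + eps * eps); first by ring.
  by rewrite xe; ring.
have Ieps c : I (c * eps).
  by rewrite /eps mulrN -mulNr mulrA mulrAC; apply: IM.
split.
  rewrite /SL2 /mkset !GL2_det_mul !det_E12 !mulr1 -GL2_det_mul mulgV.
  exact: det1.
pose P := x + x * eps.
have x'P : P * x' = 1 - eps * eps.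
  transitivity ((x * x') * (1 + eps)); first by rewrite /P; ring.
  by rewrite xe; ring.
have entries (i j : 'I_2) : exists c,
    (D *g E12 b *g D^-1%g *g E12 (- (x ^+ 2 * b))) i j - (1%:M : 'M[A]_2) i j = c * eps.
  case: (ord2P i) => ->; case: (ord2P j) => ->;
    rewrite !GL2M DV !E12E !glE // !mxE /= -/P.
  - exists (- (b * P)).
    transitivity ((P * x' - 1 + eps * eps) - b * P * eps); last first.
      by rewrite x'P; ring.
    by ring.
  - exists (b * x ^+ 2 * (2%:R + eps) + b * x ^+ 2 * b * P).
    transitivity (b * P ^+ 2 - (x ^+ 2 * b) * (1 - b * P * eps)
       - (x ^+ 2 * b) * (P * x' - 1 + eps * eps)); first by ring.
    by rewrite x'P /P; ring.
  - by exists (- (b * eps)); ring.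
  exists (b * P + x ^+ 2 * b * b * eps).
  transitivity ((P * x' - 1 + eps * eps) + b * P * eps + x ^+ 2 * b * b * eps * eps).
    by ring.
  by rewrite x'P; ring.
by move=> i j; have [c] := entries i j; rewrite !mxE => ->.
Qed.

(** Suppose that an automorphism [Psi] carries the common kernel to a subgroup
    containing [Gamma I], with [g] in [I]. Up to conjugation its inverse
    preserves the group of elementary matrices, so it turns the forms [l i] into
    additive maps [t i] vanishing on the multiples of [g]. For a unit [x] modulo
    [g], the matrix [D] of [diagonal_modulo] is carried by each homomorphism to
    a matrix of [GL2 F] which normalises the elementary ones. Such a matrix is
    triangular and multiplies entries by a constant [c], whence
    [t i (x ^+ 2 * b) = c * t i b]; as [c ^+ q = c], the multiplications by
    [x ^+ (2 * q)] and by [x ^+ 2] have the same effect on [t i]. By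
    [linear_product_sqr] all the [t i] vanish on an ideal of codimension
    [2 * q], which leaves no room for more independent forms. *)
Lemma common_kernel_genuine : (2 * #|F| < n)%N ->
  genuine_non_congruence_subgroup N.
Proof.
move=> n_large; have [Ns Nnorm] := common_kernel_normal.
have Nfin := common_kernel_finite; split=> // Psi Pbij.
split; [exact: image_subgroup | exact: image_finite_index | case=> _ [I [Iid Inz sub]]].
have [g Ig g0] := ideal_nonzero Iid Inz.
have [Phi PhiK PsiK] := Pbij.
have PhiM : {morph Phi : x y / x *g y >-> x *g y}.
  by move=> x y; rewrite -{1}[x]PsiK -{1}[y]PsiK -gmulfM PhiK.
pose Phi' : {multiplicative G -> G} :=
  HB.pack Phi (isMultiplicative.Build _ _ Phi PhiM).
have Phibij : bijective Phi' by exists Psi.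
have [h [th [thE th_surj]]] := automorphism_E12 Phibij.
have sigM i : {morph (fun x => rho i (h^-1%g *g Phi' x *g h)) :
    x y / x *g y >-> x *g y}.
  by move=> x y; rewrite -gmulfM gmulfM !mulgA mulgK.
pose sig i : {multiplicative G -> GL2 F} :=
  HB.pack (fun x => rho i (h^-1%g *g Phi' x *g h))
          (isMultiplicative.Build _ _ _ (sigM i)).
pose t i b := l i (th b).
have sigE i b : sig i (E12 b) = E12 (t i b).
  have -> : sig i (E12 b) = rho i (h^-1%g *g Phi' (E12 b) *g h) by [].
  by rewrite thE !mulgA mulVg mul1g mulgVK rhoE.
have sigN i x : Gamma I x -> sig i x = 1%g.
  case/sub=> y Ny <-; rewrite /sig /= PhiK !gmulfM Ny mulg1 gmorV.
  exact: mulVg.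
have t_surj (v : 'I_n -> F) : exists b, forall i, t i b = v i.
  by have [c lc] := l_surj v; have [b tb] := th_surj c; exists b => i; rewrite /t tb.
have tD i b c : t i (b + c) = t i b + t i c.
  by apply: E12_inj; rewrite -sigE !E12D gmulfM !sigE.
have t0 i : t i 0 = 0 by apply: (addrI (t i 0)); rewrite -tD !addr0.
have tN i b : t i (- b) = - t i b.
  by apply: (addrI (t i b)); rewrite -tD !subrr t0.
have t_g i b : t i (g * b) = 0.
  by apply: E12_inj; rewrite -sigE E12_0; apply/sigN/Gamma_E12.
have t_unit i x x' y : x * x' = 1 + g * y ->
    exists2 c : F, c != 0 & forall b, t i (x ^+ 2 * b) = c * t i b.
  move=> e; have [D DG] := diagonal_modulo e; pose Y := sig i D.
  have YE b : Y *g E12 (t i b) = E12 (t i (x ^+ 2 * b)) *g Y.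
    have := sigN i _ (DG I b Iid Ig); rewrite !gmulfM gmorV !sigE tN -E12V => /divg1_eq.
    by move=> <-; rewrite mulgVK.
  have [b1 tb1] := t_surj (fun=> 1).
  have Y10 : Y 1 0 = 0.
    have e11 : (Y *g E12 (t i b1)) 1 1 = (E12 (t i (x ^+ 2 * b1)) *g Y) 1 1.
      by rewrite YE.
    move: e11; rewrite !GL2M !E12E tb1 !mulr1 mul0r add0r mul1r => e11.
    by apply: (addIr (Y 1 1)); rewrite e11 add0r.
  have := GL2_det Y; rewrite Y10 mulr0 subr0 unitfE mulf_eq0 negb_or => /andP[a0 d0].
  exists (Y 0 0 / Y 1 1) => [|b]; first by rewrite mulf_neq0 ?invr_eq0.
  have e01 : (Y *g E12 (t i b)) 0 1 = (E12 (t i (x ^+ 2 * b)) *g Y) 0 1.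
    by rewrite YE.
  move: e01; rewrite !GL2M !E12E mulr1 mul1r addrC => /addrI e01.
  by rewrite [in RHS]mulrAC e01 mulfK.
pose J (s : A) := forall i b, t i (s * b) = 0.
have Jz : J (linear_product F ^+ 2).
  apply: (@linear_product_sqr F J g) => //.
  - by move=> a b Ja Jb i c; rewrite mulrDl tD Ja Jb addr0.
  - by move=> a b Jb i c; rewrite [a * b]mulrC -mulrA Jb.
  move=> x x' y e i b; have [c c0 tc] := t_unit i x x' y e.
  rewrite mulrBl tD tN; apply/eqP; rewrite subr_eq0; apply/eqP.
  have pow k d : t i (x ^+ (2 * k) * d) = c ^+ k * t i d.
    elim: k d => [|k IH] d; first by rewrite muln0 !expr0 !mul1r.
    by rewrite mulnS exprD -mulrA tc IH mulrA exprS.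
  by rewrite pow tc expf_card.
(* By division with remainder, the n maps are jointly onto already on the
   polynomials of size at most 2 q. *)
have sz : size (linear_product F ^+ 2) = (2 * #|F|).+1.
  have z0 : linear_product F != 0 by rewrite -size_poly_gt0 size_linear_product.
  rewrite -[LHS]prednK ?size_poly_gt0 ?expf_neq0 //.
  by rewrite size_exp size_linear_product /= mulnC.
have z20 : linear_product F ^+ 2 != 0 by rewrite -size_poly_gt0 sz.
pose T (v : {ffun 'I_(2 * #|F|) -> F}) : {ffun 'I_n -> F} :=
  [ffun i => t i (\poly_(k < 2 * #|F|) (if insub k is Some k' then v k' else 0))].
have T_surj v : exists w, T w = v.
  have [b tb] := t_surj v; pose r := b %% (linear_product F ^+ 2).
  exists [ffun k : 'I_(2 * #|F|) => r`_k]; apply/ffunP => i; rewrite ffunE.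
  have -> : \poly_(k < 2 * #|F|)
      (if insub k is Some k' then [ffun k : 'I_(2 * #|F|) => r`_k] k' else 0) = r.
    apply/polyP => k; rewrite coef_poly; case: ltnP => [lt_k|le_k].
      by rewrite insubT ffunE.
    rewrite nth_default //; apply: leq_trans le_k.
    by rewrite -ltnS -sz ltn_modp.
  by rewrite -tb [in RHS](divp_eq b (linear_product F ^+ 2)) tD mulrC Jz add0r.
have [T' T'K] := choice T_surj.
have := leq_card T' (can_inj T'K).
rewrite !card_ffun !card_ord leq_exp2l ?card_finNzRing_gt1 //.
by rewrite leqNgt n_large.
Qed.

End CommonKernel.

Theorem exists_genuine (F : finFieldType) : exists N : set (GL2 {poly F}),
  is_normal_subgroup N /\ genuine_non_congruence_subgroup N.
Proof.
pose n := (2 * #|F|).+1.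
(* The coefficient of index 0 is added so that every form has value 1 at 1. *)
pose l (i : 'I_n) (b : {poly F}) := b`_0 + (if i == 0 then 0 else b`_i).
have ll i : scalar (l i).
  move=> a b c; rewrite /l !coefD !coefZ; case: eqP => _; ring.
have l1 i : l i 1 = 1.
  rewrite /l !coef1 eqxx; case: eqP => [|i0]; first by rewrite addr0.
  by rewrite (_ : (_ == _) = false) ?addr0 //; apply/negP => /eqP e; apply/i0/val_inj.
have rhoP i : exists rho : {multiplicative GL2 {poly F} -> GL2 F},
    forall b, rho (E12 b) = E12 (l i b).
  by have [rho [_ rE]] := retraction (ll i) (l1 i); exists rho.
have [rho rhoE] := choice rhoP.
exists (common_kernel rho); split; first exact: common_kernel_normal.
apply: (common_kernel_genuine rhoE) => // v.
exists (\poly_(k < n) (if k == 0%N then v 0 else v (inord k) - v 0)) => i.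
rewrite /l !coef_poly /= ltn_ord inord_val; case: eqP => [->|i0].
  by rewrite addr0.
by rewrite (_ : (_ == _) = false) ?subrKC //; apply/negP => /eqP e; apply/i0/val_inj.
Qed.

(** * Small non-congruence subgroups *)

Section SparseForm.
Variable F : fieldType.
Local Notation A := {poly F}.
Variable a : F.

(** The linear form on polynomials with value [a] at [1] and, on the positive
    powers of the variable, value [1] if the exponent is a power of two and [0]
    otherwise. The gaps between these exponents keep growing, so the form does
    not vanish on any nonzero ideal. *)
Definition sparse_seq (k : nat) : F :=
  if k == 0%N then a else (k == 2 ^ trunc_log 2 k)%N%:R.

Definition sparse_form (b : A) : F := \sum_(k < size b) sparse_seq k * b`_k.

Lemma sparse_form_widen n (b : A) : (size b <= n)%N ->
  sparse_form b = \sum_(k < n) sparse_seq k * b`_k.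
Proof.
move=> le_n; rewrite /sparse_form.
rewrite -!(big_mkord predT (fun k => sparse_seq k * b`_k)).
rewrite [RHS](big_cat_nat _ le_n) //=.
have -> : \sum_(size b <= k < n) sparse_seq k * b`_k = 0; last by rewrite addr0.
rewrite big_nat_cond big1 // => k /andP[/andP[le_k _] _].
by rewrite nth_default ?mulr0.
Qed.

Lemma sparse_form_scalar : scalar sparse_form.
Proof.
move=> c b b'; pose n := maxn (size b) (size b').
rewrite (@sparse_form_widen n (c *: b + b')); last first.
  apply: leq_trans (size_polyD _ _) _; rewrite /n geq_max leq_maxr andbT.
  exact: leq_trans (size_scale_leq _ _) (leq_maxl _ _).
rewrite (@sparse_form_widen n b) ?leq_maxl // (@sparse_form_widen n b') ?leq_maxr //.
rewrite mulr_sumr -big_split /=; apply: eq_bigr => k _.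
by rewrite coefD coefZ; ring.
Qed.

Lemma sparse_form1 : sparse_form 1 = a.
Proof. by rewrite /sparse_form size_poly1 big_ord1 coef1 mulr1. Qed.

Lemma sparse_form_ideal (g : A) : g != 0 -> exists b, sparse_form (g * b) != 0.
Proof.
(* The shift moves the leading coefficient of g to an exponent 2 ^ d.+1, and the
   others into the gap below it. *)
move=> g0; pose d := (size g).-1; exists 'X^(2 ^ d.+1 - d).
have lt_d : (d < 2 ^ d)%N by apply: ltn_expl.
have e2 : (2 ^ d.+1 = 2 * 2 ^ d)%N by rewrite expnS.
have sg : size g = d.+1 by rewrite prednK // size_poly_gt0.
have sE : size (g * 'X^(2 ^ d.+1 - d)) = (2 ^ d.+1).+1.
  by rewrite size_mulXn // sg; lia.
rewrite /sparse_form sE big_ord_recr /= big1 ?add0r => [|k _]; last first.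
  rewrite coefMXn; case: ltnP => [_|le_k]; first by rewrite mulr0.
  have lt_k := ltn_ord k.
  have -> : sparse_seq k = 0; last by rewrite mul0r.
  have k_d : (2 ^ d < k)%N by lia.
  rewrite /sparse_seq (@trunc_log_eq 2 d k) ?(ltnW k_d) //.
  by rewrite !gtn_eqF //; lia.
rewrite coefMXn /sparse_seq expn_eq0 /= trunc_expnK // eqxx mul1r.
rewrite (_ : (2 ^ d.+1 < 2 ^ d.+1 - d)%N = false); last by apply/negbTE; lia.
rewrite subKn; last by lia.
by rewrite -[g`_d]/(lead_coef g) lead_coef_eq0.
Qed.

End SparseForm.

Section SmallSubgroup.
Variable F : finFieldType.
Local Notation A := {poly F}.
Local Notation G := (GL2 A).

(** The kernel of one homomorphism. *)
Definition kernel (rho : {multiplicative G -> GL2 F}) : set G :=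
  common_kernel (fun _ : 'I_1 => rho).

Lemma kernelP (rho : {multiplicative G -> GL2 F}) x y :
  rho x = rho y -> kernel rho (x^-1%g *g y).
Proof. by move=> e i; rewrite gmulfM gmorV e mulVg. Qed.

Lemma kernel_non_congruence (a : F) (rho : {multiplicative G -> GL2 F}) :
  (forall b, rho (E12 b) = E12 (sparse_form a b)) ->
  non_congruence_subgroup (kernel rho).
Proof.
move=> rE; have [Ns _] := common_kernel_normal (fun _ : 'I_1 => rho).
split=> //; first exact: common_kernel_finite.
case=> _ [I [Iid Inz sub]]; have [g Ig g0] := ideal_nonzero Iid Inz.
have [b] := sparse_form_ideal a g0; case/eqP; apply: E12_inj.
by rewrite -rE E12_0; apply: (sub _ (Gamma_E12 b Iid Ig) ord0).
Qed.

Lemma small_retraction : exists N : set G, [/\ is_normal_subgroup N,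
  non_congruence_subgroup N &
  (subgroup_index N <= #|F| * #|F|.-1 ^ 2 * #|F|.+1)%N].
Proof.
have [rho [rg rE]] := retraction (@sparse_form_scalar F 1) (sparse_form1 (1 : F)).
have Nn := common_kernel_normal (fun _ : 'I_1 => rho).
exists (kernel rho); split=> //; first exact: kernel_non_congruence rE.
rewrite -card_GL_2 cardsT; have [Ns _] := Nn.
have [] := @index_le _ (kernel rho) Ns {'GL_2[F]} predT
  (fun x => to_GL (rho x)) (fun _ => isT) => // x y /(can_inj (@to_GLK F)).
exact: kernelP.
Qed.

Lemma small_affine : (forall a : F, a != 0 -> a ^+ 2 = 1) ->
  exists N : set G, [/\ is_normal_subgroup N, non_congruence_subgroup N &
    (subgroup_index N <= #|F|.-1 * #|F|)%N].
Proof.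
move=> sq1.
have [rho [rg rE]] :=
  affine_quotient sq1 (@sparse_form_scalar F 0) (sparse_form1 (0 : F)).
have Nn := common_kernel_normal (fun _ : 'I_1 => rho).
exists (kernel rho); split=> //; first exact: kernel_non_congruence rE.
have n10 := oner_neq0 F.
have bot x : rho x 1 0 = 0 /\ rho x 1 1 = 1.
  elim/GL2_poly_ind: x => [|g x [e0 e1]|b x [e0 e1]].
  - by rewrite gmor1 !GL2_1E.
  - by rewrite gmulfM rg !GL2M !dgE ?GL2F_det // e0 e1; split; ring.
  by rewrite gmulfM rE !GL2M !E12E e0 e1; split; ring.
have [Ns _] := Nn.
rewrite -(cardC1 (0 : F)) -cardX.
have [] := @index_le _ (kernel rho) Ns (F * F)%type
  [predX predC1 (0 : F) & F] (fun x => (rho x 0 0, rho x 0 1)) => // x.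
  rewrite !inE /= andbT; have := GL2_det (rho x); have [-> ->] := bot x.
  by rewrite mulr1 mulr0 subr0 unitfE.
move=> y [e00 e01]; apply: kernelP; have [x10 x11] := bot x.
by have [y10 y11] := bot y; apply: GL2P; rewrite ?x10 ?x11 ?y10 ?y11.
Qed.

End SmallSubgroup.

(** The least element of a nonempty set is attained and minimal. *)
Lemma leastP (P : set nat) n : P n -> P (least P) /\ (least P <= n)%N.
Proof.
move=> Pn; have ex : exists m, `[< P m >] by exists n; apply/asboolP.
case: (ex_minnP ex) => m /asboolP Pm min_m.
have : [set k | P k /\ forall i, P i -> (k <= i)%N]%classic m.
  by split=> // i Pi; apply/min_m/asboolP.
by move/(xgetI 0%N); rewrite -/(least P) => -[Pl le_l]; split=> //; apply: le_l.
Qed.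

(** The kernels of the sparse forms have smaller index than the divisor of the
    index of every normal genuine subgroup. *)
Theorem nncs_lt_ngncs (F : finFieldType) : (nncs F < ngncs F)%N.
Proof.
have q1 := card_finNzRing_gt1 F.
have [N1 [N1n N1nc le1]] : exists N : set (GL2 {poly F}), [/\ is_normal_subgroup N,
    non_congruence_subgroup N & (subgroup_index N <
    if (3 < #|F|)%N then #|F| * card_PGL2 F else #|F| ^ 2)%N].
  case: ltnP => [q3|q3].
    have [N [Nn Nnc le_N]] := small_retraction F; exists N; split=> //.
    apply: leq_ltn_trans le_N _; rewrite card_PGL2E.
    move: q3; case: #|F| => // k k2; rewrite /=.
    rewrite (_ : (k.+1 ^ 2 - 1 = k * k.+2)%N); last by lia.
    have -> : (k.+1 * k ^ 2 * k.+2 = k.+1 * k * k.+2 * k)%N by lia.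
    have -> : (k.+1 * (k.+1 * (k * k.+2)) = k.+1 * k * k.+2 * k.+1)%N by lia.
    by rewrite ltn_pmul2l // !muln_gt0 /=; lia.
  have sq1 (a : F) : a != 0 -> a ^+ 2 = 1.
    move=> a0; have := expf_card a; move: q1 q3.
    case: #|F| => [|[|[|[|]]]] // _ _.
      by move=> e; rewrite e; apply: (mulfI a0); rewrite -expr2 e mulr1.
    by move=> e; apply: (mulfI a0); rewrite -exprS e mulr1.
  have [N [Nn Nnc le_N]] := small_affine sq1; exists N; split=> //.
  apply: leq_ltn_trans le_N _; move: q1; case: #|F| => // k _; rewrite /=; nia.
have le_nncs : (nncs F <= subgroup_index N1)%N.
  by apply: (leastP (n := subgroup_index N1) _).2; exists N1.
have [N [Nn Ng]] := exists_genuine F.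
have [M [Mn Mg] Mi] : [set subgroup_index N | N in
    [set N : set (GL2 {poly F}) | is_normal_subgroup N /\
       genuine_non_congruence_subgroup N]]%classic (ngncs F).
  by apply: (leastP (n := subgroup_index N) _).1; exists N.
apply: leq_ltn_trans le_nncs (leq_trans le1 _).
have [Ms Mfin _] := Mg.
by rewrite -Mi; apply: dvdn_leq (index_gt0 Mfin) (genuine_index_dvd Mn Mg).
Qed.

Theorem theorem6p4 (F : finFieldType) (q : nat) (hq : #|F| = q) :
  [/\ (3 < q)%N -> (q * card_PGL2 F = q ^ 4 - q ^ 2)%N,
      forall N : set (GL2 {poly F}),
        is_normal_subgroup N -> genuine_non_congruence_subgroup N ->
        ((if (3 < q)%N then q * card_PGL2 F else q ^ 2) %| subgroup_index N)%N
    & (nncs F < ngncs F)%N].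
Proof.
split; last exact: nncs_lt_ngncs.
  by move=> _; rewrite card_PGL2E hq; nia.
by move=> N Nn Ng; rewrite -hq; apply: genuine_index_dvd.
Qed.
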